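(* Run the method RR-sc with the blockwise step sizes $\alpha_t=\alpha_{\rm sc}^{(k)}$ for $t\in\{T_k,\dots,T_k+S_k-1\}$, $k=0,1,2,\dots$ (all defined in the context). Then, with probability at least $1-\delta$, RR-sc terminates at some iteration $\tau$ satisfying $$n\tau=\tilde{\mathcal O}\left(\max\left\{n(\eta\varepsilon)^{-2},\ \sqrt n\,(\eta\varepsilon)^{-3}\right\}\right),$$ and the returned last iterate $x_\tau$ satisfies $$\|\nabla f(x_\tau)\|\le\sqrt{\tfrac{28}{9}}\,\eta\varepsilon.$$
   Context: Problem: $f(x)=\frac1n\sum_{i=1}^n f_i(x)$ on $\mathbb{R}^d$. Each $f_i:\mathbb{R}^d\to\mathbb{R}$ is continuously differentiable (not necessarily convex), bounded from below by $\bar f_i\in\mathbb{R}$, and $\nabla f_i$ is Lipschitz continuous with parameter $L>0$. Let $\bar f$ be a lower bound of $f$ (e.g. its optimal value), and set $A=2L>0$ and $B=\frac{A}{n}\sum_{i=1}^n(\bar f-\bar f_i)$, with $\bar f$ such that $B\ge0$ (automatic if $\bar f=\inf f$). Set $F:=3(f(x_0)-\bar f)+3B/A\ge0$. $\|\cdot\|$ is the Euclidean norm. RR-sc with tolerance $\eta>0$ and accuracy $\varepsilon>0$: let $\Pi$ be the set of all permutations of $\{1,\dots,n\}$. Starting from a deterministic $x_0$, at epoch $t=0,1,\dots$ a permutation $\pi_t=(\pi_t^1,\dots,\pi_t^n)$ is sampled uniformly at random from $\Pi$, independently of the past; set $x_t^0=x_t$, $x_t^i=x_t^{i-1}-\alpha_t\nabla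 f_{\pi_t^i}(x_t^{i-1})$ for $i=1,\dots,n$, and $g_t=\frac1n\sum_{i=1}^n\nabla f_{\pi_t^i}(x_t^{i-1})$. If $\|g_t\|\le\eta\varepsilon$, the method stops, sets $\tau=t$ and returns $x_\tau$; otherwise $x_{t+1}=x_t^n$ and it continues. Thus $\tau$ is the first $t$ with $\|g_t\|\le\eta\varepsilon$ ($\tau=\infty$ if there is none). Blockwise step sizes: let $\delta\in(0,1)$. For $k=0,1,2,\dots$ let $S_k=2^k$, $T_k=\sum_{j=0}^{k-1}S_j=2^k-1$ ($T_0=0$), $\delta_k=\frac{6\delta}{\pi^2(k+1)^2}$ (here $\pi=3.14\ldots$), $\ell_k=\log(8nS_k/\delta_k)$, and $$\alpha_t=\alpha_{\rm sc}^{(k)}:=\min\left\{\frac1{4nL},\ \frac{\eta\varepsilon}{8\sqrt{nAF}\,L\,\ell_k}\right\},\qquad t\in\{T_k,\dots,T_k+S_k-1\},$$ where the second term is read as $+\infty$ if $F=0$. Complexity notation: $\tilde{\mathcal O}$ hides problem constants and logarithmic factors in $n$, $1/\delta$, $1/\varepsilon$ ($\eta$ being a constant). Precisely: there are an absolute constant $p$ and a constant $C$ depending only on $L$, $f(x_0)-\bar f$ and $B$ such that, whenever $0<\eta\varepsilon\le1$, the event of probability at least $1-\delta$ in the claim has $n\tau\le C\max\{n(\eta\varepsilon)^{-2},\sqrt n(\eta\varepsilon)^{-3}\}\,(1+\log n+\log(1/\delta)+\log(1/(\eta\varepsilon)))^p$. *)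

(* Defs.v *)
From HB Require Import structures.
From mathcomp Require Export all_boot all_order all_fingroup all_algebra.
From mathcomp Require Export all_classical all_reals all_analysis.
Export Order.TTheory GRing.Theory Num.Theory numFieldNormedType.Exports.

#[export] Set Implicit Arguments.
#[export] Unset Strict Implicit.
#[export] Unset Printing Implicit Defensive.

Local Open Scope classical_set_scope.
Local Open Scope ring_scope.

(* The library's norm on 'rV[R]_d is the sup norm; it induces the same topology
   (hence the same notions of differentiability and continuity) as the
   Euclidean norm. *)
Definition enorm (R : realType) (d : nat) (x : 'rV[R]_d) : R :=
  Num.sqrt (\sum_(j < d) x 0 j ^+ 2).

Definition grad (R : realType) (d : nat) (h : 'rV[R]_d -> R) (x : 'rV[R]_d) :
    'rV[R]_d :=
  \row_(j < d) 'D_(delta_mx 0 j) (h : 'rV[R]_d -> R^o) x.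

Definition continuously_differentiable (R : realType) (d : nat)
    (h : 'rV[R]_d -> R) : Prop :=
  (forall x, differentiable (h : 'rV[R]_d -> R^o) x) /\ continuous (grad h).

Definition lipschitz_grad (R : realType) (d : nat) (L : R)
    (h : 'rV[R]_d -> R) : Prop :=
  forall x y, enorm (grad h x - grad h y) <= L * enorm (x - y).

Definition favg (R : realType) (n d : nat) (f : 'I_n -> 'rV[R]_d -> R)
    (x : 'rV[R]_d) : R :=
  n%:R^-1 * \sum_(i < n) f i x.

Definition constA (R : realType) (L : R) : R := 2 * L.

Definition constB (R : realType) (n : nat) (L fbar : R) (fbar_ : 'I_n -> R) : R :=
  constA L / n%:R * \sum_(i < n) (fbar - fbar_ i).

Definition constF (R : realType) (n d : nat) (f : 'I_n -> 'rV[R]_d -> R)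
    (L fbar : R) (fbar_ : 'I_n -> R) (x0 : 'rV[R]_d) : R :=
  3 * (favg f x0 - fbar) + 3 * constB L fbar fbar_ / constA L.

(* Inner iterates of one epoch started at x with step size a and permutation s:
   rr_inner f a s x i is x_t^i. Components are indexed from 0, so the step from
   x_t^i to x_t^(i+1) uses the component s i; beyond i = n nothing changes. *)
Fixpoint rr_inner (R : realType) (n d : nat) (f : 'I_n -> 'rV[R]_d -> R)
    (a : R) (s : 'S_n) (x : 'rV[R]_d) (i : nat) : 'rV[R]_d :=
  match i with
  | 0 => x
  | i'.+1 =>
      let y := rr_inner f a s x i' in
      match insub i' : option 'I_n with
      | Some j => y - a *: grad (f (s j)) y
      | None => y
      end
  end.

(* Outer iterates x_t. The recursion ignores the stopping test, so x_t coincides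
   with the iterate of RR-sc exactly as long as the method has not stopped, that
   is, for t <= tau. *)
Fixpoint rr_iter (R : realType) (n d : nat) (f : 'I_n -> 'rV[R]_d -> R)
    (alpha : nat -> R) (s : nat -> 'S_n) (x0 : 'rV[R]_d) (t : nat) : 'rV[R]_d :=
  match t with
  | 0 => x0
  | t'.+1 => rr_inner f (alpha t') (s t') (rr_iter f alpha s x0 t') n
  end.

Definition rr_g (R : realType) (n d : nat) (f : 'I_n -> 'rV[R]_d -> R)
    (alpha : nat -> R) (s : nat -> 'S_n) (x0 : 'rV[R]_d) (t : nat) : 'rV[R]_d :=
  n%:R^-1 *: \sum_(i < n)
    grad (f (s t i)) (rr_inner f (alpha t) (s t) (rr_iter f alpha s x0 t) i).

(* RR-sc with stopping threshold thr (= eta * eps) stops at epoch tau. *)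
Definition rr_stops_at (R : realType) (n d : nat) (f : 'I_n -> 'rV[R]_d -> R)
    (alpha : nat -> R) (s : nat -> 'S_n) (x0 : 'rV[R]_d) (thr : R) (tau : nat) :
    Prop :=
  enorm (rr_g f alpha s x0 tau) <= thr /\
  forall t : nat, (t < tau)%N -> ~ (enorm (rr_g f alpha s x0 t) <= thr).

(* Uniform random permutations, each independent of the past; 'S_n carries the
   discrete sigma-algebra. The sequence is infinite: the permutations drawn after
   the stopping time are not used. *)
Definition rr_sampling (R : realType) (dT : measure_display)
    (T : measurableType dT) (P : probability T R) (n : nat)
    (perms : nat -> T -> 'S_n) : Prop :=
  [/\ forall (t : nat) (S : set 'S_n), measurable (perms t @^-1` S),
      forall (t : nat) (s : 'S_n),
        P (perms t @^-1` [set s]) = ((n`!)%:R^-1 : R)%:E &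
      forall (t : nat) (H : set ('I_t -> 'S_n)) (S : set 'S_n),
        let past := [set w | H (fun u : 'I_t => perms u w)] in
        P (past `&` perms t @^-1` S) = (P past * P (perms t @^-1` S))%E].

Definition blockS (k : nat) : nat := (2 ^ k)%N.

Definition blockT (k : nat) : nat := (\sum_(0 <= j < k) blockS j)%N.

Definition delta_sc (R : realType) (delta : R) (k : nat) : R :=
  6 * delta / (pi ^+ 2 * k.+1%:R ^+ 2).

Definition ell_sc (R : realType) (n : nat) (delta : R) (k : nat) : R :=
  ln (8 * n%:R * (blockS k)%:R / delta_sc delta k).

(* When F = 0 the second term of the minimum is read as +oo. *)
Definition alpha_sc (R : realType) (n : nat) (L F thr delta : R) (k : nat) : R :=
  let a1 := 1 / (4 * n%:R * L) in
  if F == 0 then a1 else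
  Num.min a1
    (thr / (8 * Num.sqrt (n%:R * constA L * F) * L * ell_sc n delta k)).

(* Main.v *)
(** With [W = n A F / 3], every epoch started at a point [x] with [f x <= f x0] has
    [\sum_i |grad f_i x - grad f x|^2 <= W], because an L-smooth function bounded
    below by [b] satisfies [|grad h|^2 <= 2 L (h - b)].  Partial sums of a uniformly
    shuffled centred family of energy at most [W] exceed [4 sqrt W l] with probability
    at most [(5/2) exp (- l)]: revealing the permutation one value at a time, the
    squared increments are compensated by the loss of energy of the remaining
    vectors, so [exp (energy) * cosh |partial sum|] is a supermartingale up to
    scaling, with a bound free of the dimension.

    If all these partial sums are at most [D], then
    [|g - grad f x| <= (4/3) alpha L D + |grad f x| / 6], and the step sizes make
    [alpha L D <= (3/10) eta eps].  Hence stopping forces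
    [|grad f x| <= sqrt (28/9) eta eps], while every epoch that does not stop lowers
    [f] by [alpha n (eta eps)^2 / 5].  A full block [k] without stopping thus forces
    [2^k] to be at most linear in [ell_k], that is, in [k] and the logarithms.  A union
    bound over the epochs, with [\sum_k delta_k <= 3 delta], gives the probability. *)
Require Import Defs.
From mathcomp Require Import ring lra zify.
Local Open Scope classical_set_scope.
Local Open Scope ring_scope.

(** * Euclidean inner product and norm *)

Definition dotv (R : realType) (d : nat) (x y : 'rV[R]_d) : R :=
  \sum_(j < d) x 0 j * y 0 j.

Section Euclidean.
Context {R : realType} {d : nat}.
Implicit Types (x y z : 'rV[R]_d) (a : R).

Lemma dotvC x y : dotv x y = dotv y x.
Proof. by apply: eq_bigr => j _; rewrite mulrC. Qed.

Lemma dotvDl x y z : dotv (x + y) z = dotv x z + dotv y z.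
Proof. by rewrite /dotv -big_split; apply: eq_bigr => j _; rewrite !mxE mulrDl. Qed.

Lemma dotvZl a x y : dotv (a *: x) y = a * dotv x y.
Proof. by rewrite /dotv mulr_sumr; apply: eq_bigr => j _; rewrite !mxE mulrA. Qed.

Lemma dotvDr x y z : dotv x (y + z) = dotv x y + dotv x z.
Proof. by rewrite dotvC dotvDl !(dotvC x). Qed.

Lemma dotvZr a x y : dotv x (a *: y) = a * dotv x y.
Proof. by rewrite dotvC dotvZl dotvC. Qed.

Lemma dotvNr x y : dotv x (- y) = - dotv x y.
Proof. by rewrite -scaleN1r dotvZr mulN1r. Qed.

Lemma dotvNl x y : dotv (- x) y = - dotv x y.
Proof. by rewrite dotvC dotvNr dotvC. Qed.

Lemma dot0v x : dotv 0 x = 0.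
Proof. by rewrite -(scale0r 0) dotvZl mul0r. Qed.

Lemma dotv_sumr (I : Type) (r : seq I) (P : pred I) (F : I -> 'rV[R]_d) x :
  dotv x (\sum_(i <- r | P i) F i) = \sum_(i <- r | P i) dotv x (F i).
Proof.
elim/big_rec2: _ => [|i u v _ <-]; first by rewrite dotvC dot0v.
by rewrite dotvDr.
Qed.

Lemma enorm_ge0 x : 0 <= enorm x.
Proof. exact: sqrtr_ge0. Qed.

Lemma enorm_sqr x : enorm x ^+ 2 = dotv x x.
Proof. by rewrite sqr_sqrtr; [|apply: sumr_ge0 => j _; rewrite sqr_ge0]. Qed.

Lemma enorm0 : enorm (0 : 'rV[R]_d) = 0.
Proof. by apply/eqP; rewrite -sqrf_eq0 enorm_sqr dot0v. Qed.

Lemma enormZ a x : enorm (a *: x) = `|a| * enorm x.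
Proof.
apply/eqP; rewrite -(@eqrXn2 _ 2) ?mulr_ge0 ?enorm_ge0//.
by rewrite exprMn !enorm_sqr dotvZl dotvZr mulrA real_normK ?num_real // expr2.
Qed.

Lemma enormN x : enorm (- x) = enorm x.
Proof. by rewrite -scaleN1r enormZ normrN1 mul1r. Qed.

Lemma enormDsqr x y :
  enorm (x + y) ^+ 2 = enorm x ^+ 2 + 2 * dotv x y + enorm y ^+ 2.
Proof. by rewrite !enorm_sqr dotvDl !dotvDr (dotvC y x); ring. Qed.

Lemma enormBsqr x y :
  enorm (x - y) ^+ 2 = enorm x ^+ 2 - 2 * dotv x y + enorm y ^+ 2.
Proof. by rewrite enormDsqr enormN dotvNr; ring. Qed.

Lemma enorm_eq0 x : enorm x = 0 -> x = 0.
Proof.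
move=> /(congr1 (fun t => t ^+ 2)); rewrite expr0n enorm_sqr /= => /eqP.
rewrite psumr_eq0 => [/allP h|j _]; last by rewrite -expr2 sqr_ge0.
apply/rowP => j; rewrite mxE.
by have := h j (mem_index_enum _); rewrite /= -expr2 sqrf_eq0 => /eqP.
Qed.

(** Cauchy-Schwarz: the squared norm of [|y| x - |x| y] equals [2 |x| |y| (|x| |y| - <x, y>)]. *)
Lemma dotv_le x y : dotv x y <= enorm x * enorm y.
Proof.
have := enorm_ge0 x; rewrite le_eqVlt => /predU1P[/esym hx|x0].
  by rewrite (enorm_eq0 hx) enorm0 mul0r dot0v.
have := enorm_ge0 y; rewrite le_eqVlt => /predU1P[/esym hy|y0].
  by rewrite (enorm_eq0 hy) enorm0 mulr0 dotvC dot0v.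
have := sqr_ge0 (enorm (enorm y *: x - enorm x *: y)).
rewrite enormBsqr !enormZ dotvZl dotvZr !ger0_norm ?enorm_ge0//.
have xy0 := mulr_gt0 x0 y0.
set p := dotv x y; set a := enorm x in x0 xy0 *; set b := enorm y in y0 xy0 *.
move=> h; have : 0 <= (a * b) * (a * b - p) by lra.
by rewrite pmulr_rge0// subr_ge0.
Qed.

Lemma normr_dotv_le x y : `|dotv x y| <= enorm x * enorm y.
Proof.
by rewrite ler_norml dotv_le lerNl -dotvNl -(enormN x) dotv_le.
Qed.

Lemma ler_enormD x y : enorm (x + y) <= enorm x + enorm y.
Proof.
rewrite -(@ler_pXn2r _ 2)// ?nnegrE ?addr_ge0 ?enorm_ge0//.
rewrite enormDsqr sqrrD lerD2r lerD2l mulr2n.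
by have := dotv_le x y; lra.
Qed.

Lemma ler_enormB x y : enorm (x - y) <= enorm x + enorm y.
Proof. by rewrite -(enormN y) ler_enormD. Qed.

Lemma ler_enorm_sum (I : Type) (r : seq I) (P : pred I) (F : I -> 'rV[R]_d) :
  enorm (\sum_(i <- r | P i) F i) <= \sum_(i <- r | P i) enorm (F i).
Proof.
elim/big_rec2: _ => [|i u v _ h]; first by rewrite enorm0.
by rewrite (le_trans (ler_enormD _ _))// lerD2l.
Qed.

End Euclidean.

(** * Convexity and one-step growth of the hyperbolic cosine *)

Definition coshR (R : realType) (x : R) : R := (expR x + expR (- x)) / 2.

Section Cosh.
Context {R : realType}.
Implicit Types a b r u v t y : R.

Lemma coshR_ge0 a : 0 <= coshR a.
Proof. by rewrite divr_ge0// addr_ge0 ?expR_ge0. Qed.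

Lemma le_expR_coshR a : expR a / 2 <= coshR a.
Proof. by rewrite ler_pM2r ?invr_gt0// lerDl expR_ge0. Qed.

Lemma coshR0 : coshR (0 : R) = 1.
Proof. by rewrite /coshR oppr0 expR0 divff. Qed.

(** By induction on [n]: the step leaves the gap [t (1 - t) (a - b) (a ^+ n - b ^+ n)], whose two
    differences have the same sign. *)
Lemma convex_exprn (t a b : R) n : 0 <= t <= 1 -> 0 <= a -> 0 <= b ->
  (t * a + (1 - t) * b) ^+ n <= t * a ^+ n + (1 - t) * b ^+ n.
Proof.
move=> /andP[t0 t1] a0 b0; elim: n => [|n IH]; first by rewrite !expr0; lra.
have c0 : 0 <= t * a + (1 - t) * b by rewrite addr_ge0 ?mulr_ge0 ?subr_ge0.
rewrite exprS (le_trans (ler_wpM2l c0 IH))// !exprS -subr_ge0.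
rewrite [leRHS](_ : _ = t * (1 - t) * ((a - b) * (a ^+ n - b ^+ n))); last by ring.
apply: mulr_ge0; first by rewrite mulr_ge0// subr_ge0.
have [ab|/ltW ba] := lerP a b.
  by rewrite mulr_le0// subr_le0// lerXn2r// nnegrE.
by rewrite mulr_ge0// subr_ge0// lerXn2r// nnegrE.
Qed.

(* [cosh \o sqrt] has nonnegative Taylor coefficients, hence is convex. *)
Lemma coshR_sqrt_convex t r u v : 0 <= t <= 1 ->
  r ^+ 2 = t * u ^+ 2 + (1 - t) * v ^+ 2 ->
  coshR r <= t * coshR u + (1 - t) * coshR v.
Proof.
move=> t01 hr.
have ccosh a : (fun N => (series (exp_coeff a) N + series (exp_coeff (- a)) N) / 2)
    @ \oo --> coshR a.
  by apply: cvgMl; apply: cvgD; exact: is_cvg_series_exp_coeff.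
have cR : (fun N =>
    t * ((series (exp_coeff u) N + series (exp_coeff (- u)) N) / 2) +
    (1 - t) * ((series (exp_coeff v) N + series (exp_coeff (- v)) N) / 2))
    @ \oo --> t * coshR u + (1 - t) * coshR v.
  by apply: cvgD; apply: cvgMr.
apply: ler_cvg_to (ccosh r) cR _; apply: nearW => N.
rewrite !mulrA -mulrDl ler_pM2r ?invr_gt0// /series /= -!big_split/= !mulr_sumr.
rewrite -big_split/= ler_sum// => k _; rewrite /exp_coeff /= -!mulrDl !mulrA -!mulrDl.
rewrite ler_pM2r ?invr_gt0 ?ltr0n ?fact_gt0//.
(* Odd terms of the two exponential series cancel; even ones are powers of squares, to which
   [convex_exprn] applies. *)
rewrite -(odd_double_half k); case: (odd k); rewrite /= ?add1n ?add0n.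
  have oddE (w : R) : w ^+ (k./2.*2.+1) + (- w) ^+ (k./2.*2.+1) = 0.
    by rewrite exprNn -signr_odd /= odd_double expr1 mulN1r subrr.
  by rewrite !oddE !mulr0 addr0.
have evE (w : R) : w ^+ (k./2.*2) + (- w) ^+ (k./2.*2) = 2 * (w ^+ 2) ^+ k./2.
  by rewrite exprNn -signr_odd odd_double expr0 mul1r -exprM mul2n; ring.
rewrite !evE hr.
have := convex_exprn k./2 t01 (sqr_ge0 u) (sqr_ge0 v).
lra.
Qed.

(** After inversion, [1 + z <= expR z] with [z = y ^+ 2 - y] settles [y >= 0]. For [y < 0] it is too
    weak at third order, so it is applied to [z / 2] and squared; there [y >= - 1/4] keeps the
    remainder nonnegative. *)
Lemma expR_subsqr_le y : - (1 / 4) <= y -> expR (y - y ^+ 2) <= 1 + y.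
Proof.
move=> hy.
rewrite -[y - _]opprK expRN -[1 + y]invrK lef_pV2 ?posrE ?expR_gt0 ?invr_gt0//; last lra.
have [y0|yn] := lerP 0 y.
  apply: (le_trans _ (expR_ge1Dx _)).
  by rewrite -div1r ler_pdivrMr; [nra|lra].
rewrite [leRHS](_ : _ = expR (- (y - y ^+ 2) / 2) ^+ 2); last first.
  by rewrite -expRM_natr; congr expR; field.
have h : 1 + (- (y - y ^+ 2) / 2) <= expR (- (y - y ^+ 2) / 2) := expR_ge1Dx _.
apply: (@le_trans _ _ ((1 + (- (y - y ^+ 2) / 2)) ^+ 2)); last first.
  have hy2 := sqr_ge0 y.
  by apply: lerXn2r h; rewrite nnegrE ?expR_ge0//; lra.
rewrite -div1r ler_pdivrMr; last lra.
have [b hb] : exists b, y = - b by exists (- y); rewrite opprK.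
subst y.
have -> : (1 + - (- b - (- b) ^+ 2) / 2) ^+ 2 * (1 + - b) =
   1 + b ^+ 2 * (1 - 3 * b - b ^+ 2 - b ^+ 3) / 4 by field.
rewrite lerDl mulr_ge0 ?invr_ge0// mulr_ge0 ?sqr_ge0//.
have b0 : 0 < b by lra.
have b2 : b ^+ 2 <= b * (1 / 4) by rewrite expr2 ler_pM2l//; lra.
have b3 : b ^+ 3 <= b ^+ 2 * (1 / 4) by rewrite exprSr ler_wpM2l ?sqr_ge0//; lra.
lra.
Qed.

(* The self-normalised form of Pinelis' inequality in Hilbert space: [k] is
   [sinh |x| / |x|], and after averaging over a centred [h] the linear term
   vanishes. *)
Lemma coshR_enorm_step d (x : 'rV[R]_d) : exists k : R, forall h : 'rV[R]_d,
  enorm h <= 1 / 4 ->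
  expR (- enorm h ^+ 2) * coshR (enorm (x + h)) <= coshR (enorm x) + k * dotv x h.
Proof.
pose a := enorm x; pose sh := (expR a - expR (- a)) / 2.
exists (sh / a) => h; set b := enorm h => hb.
have a0 : 0 <= a by exact: enorm_ge0.
have b0 : 0 <= b by exact: enorm_ge0.
(* [t] encodes the angle between [x] and [h]: it makes [|x + h|^2] the convex combination of
   [(a + b)^2] and [(a - b)^2]. If [a * b = 0] any [t] would do. *)
have [t [t01 tE]] : exists t, 0 <= t <= 1 /\ dotv x h = (2 * t - 1) * (a * b).
  have := normr_dotv_le x h; rewrite -/a -/b => hp.
  have [ab0|ab0] := eqVneq (a * b) 0.
    exists (1 / 2); split; first lra.
    by rewrite ab0 mulr0; apply/eqP; rewrite -normr_le0 -ab0.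
  have abp : 0 < a * b by rewrite lt_neqAle eq_sym ab0 mulr_ge0.
  exists ((1 + dotv x h / (a * b)) / 2); split; last first.
    rewrite [2 * _](_ : _ = 1 + dotv x h / (a * b)).
      by rewrite [1 + _]addrC addrK divfK.
    by rewrite mulrC divfK.
  have : `|dotv x h / (a * b)| <= 1.
    by rewrite normrM normfV (gtr0_norm abp) ler_pdivrMr// mul1r.
  by rewrite ler_norml => /andP[? ?]; apply/andP; split; lra.
have hr : enorm (x + h) ^+ 2 = t * (a + b) ^+ 2 + (1 - t) * (a - b) ^+ 2.
  by rewrite enormDsqr tE -/a -/b; ring.
have h1 := coshR_sqrt_convex t01 hr.
have hE (y : R) : - (1/4) <= y -> expR (- y ^+ 2) * expR y <= 1 + y.
  by move=> hy; rewrite -expRD addrC expR_subsqr_le.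
have hp : expR (- b ^+ 2) * expR b <= 1 + b by apply: hE; lra.
have hm : expR (- b ^+ 2) * expR (- b) <= 1 - b.
  by rewrite -[in expR (- b ^+ 2)]sqrrN; apply: hE; lra.
have e0 := expR_ge0 a; have e1 := expR_ge0 (- a).
have key1 : expR (- b ^+ 2) * coshR (a + b) <= coshR a + b * sh.
  rewrite /coshR /sh opprD !expRD.
  set E := expR (- b ^+ 2) in hp hm *.
  set p := expR a in e0 *; set q := expR (- a) in e1 *.
  have g1 := ler_wpM2l e0 hp; have g2 := ler_wpM2l e1 hm; lra.
have key2 : expR (- b ^+ 2) * coshR (a - b) <= coshR a - b * sh.
  rewrite /coshR /sh opprB (addrC b) !expRD.
  set E := expR (- b ^+ 2) in hp hm *.
  set p := expR a in e0 *; set q := expR (- a) in e1 *.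
  have g1 := ler_wpM2l e0 hm; have g2 := ler_wpM2l e1 hp; lra.
(* At [a = 0] also [sh = 0], so both sides vanish in spite of the division by zero. *)
have kE : sh / a * dotv x h = (2 * t - 1) * (b * sh).
  rewrite tE; have [az|az] := eqVneq a 0; last by field.
  by rewrite /sh az oppr0 subrr !mul0r !mulr0.
rewrite kE -/a; move: t01 => /andP[t0 t1].
apply: le_trans (ler_wpM2l (expR_ge0 _) h1) _.
have t1' : 0 <= 1 - t by lra.
have g1 := ler_wpM2l t0 key1; have g2 := ler_wpM2l t1' key2.
lra.
Qed.

End Cosh.

(** * Concentration for sampling without replacement *)

Section Reshuffling.
Context {R : realType} {d : nat}.

(** Splits a permutation into its first value and a permutation of the rest; injectivity and
    [(n + 1)! = (n + 1) n!] make the correspondence bijective. *)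
Lemma big_Sn_lift (V : nmodType) n (F : 'S_n.+1 -> V) :
  \sum_(s : 'S_n.+1) F s = \sum_(a : 'I_n.+1) \sum_(s : 'S_n) F (lift_perm ord0 a s).
Proof.
rewrite pair_big/= (reindex (fun p : 'I_n.+1 * 'S_n => lift_perm ord0 p.1 p.2))//=.
apply: onW_bij; apply: inj_card_bij => [[a s] [b t] /= h|].
  have ab : a = b by rewrite -(lift_perm_id ord0 a s) h lift_perm_id.
  subst b; congr pair; apply/permP => j; apply: (@lift_inj _ a).
  by rewrite -!(lift_perm_lift ord0) h.
by rewrite card_prod card_ord !card_Sn factS.
Qed.

(* Revealing the permutation one value at a time: if the first value is [a], the
   remaining vectors have mean [- v a / n], so the increment is a multiple of
   [v a] of norm at most [|v a|], while recentring lowers the energy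
   [\sum |v i|^2] by at least [|v a|^2]. *)
Lemma sum_coshR_reshuffle n (v : 'I_n -> 'rV[R]_d) (x : 'rV[R]_d) m :
  (m <= n)%N -> \sum_i v i = 0 -> \sum_i enorm (v i) ^+ 2 <= 1 / 16 ->
  \sum_(s : 'S_n) coshR (enorm (x + \sum_(j < n | (j < m)%N) v (s j))) <=
    n`!%:R * expR (\sum_i enorm (v i) ^+ 2) * coshR (enorm x).
Proof.
elim: n v x m => [|n IH] v x [|m] hm hv hE //.
- rewrite (eq_bigr (fun=> coshR (enorm x))) => [|s _]; last by rewrite big_ord0 addr0.
  rewrite sumr_const big_ord0 expR0 mulr1 card_Sn.
  by rewrite mulr_natl.
- rewrite (eq_bigr (fun=> coshR (enorm x))) => [|s _]; last by rewrite big_pred0 ?addr0.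
  rewrite sumr_const card_Sn -[leLHS]mulr_natl.
  rewrite ler_wpM2r ?coshR_ge0// ler_peMr ?ler0n// -expR0 ler_expR sumr_ge0// => i _.
  exact: sqr_ge0.
set E := \sum_i _ in hE *.
(* Recentring adds [v a / n] to each of the [m] later summands; removing this excess turns the first
   increment [v a] into [(1 - c) *: v a]. *)
pose c : R := m%:R / n%:R.
have c01 : 0 <= c <= 1.
  rewrite /c divr_ge0 ?ler0n//=; have [->|n0] := posnP n; first by rewrite invr0 mulr0.
  by rewrite ler_pdivrMr ?ltr0n// mul1r ler_nat.
(* [k] is fixed before the first value [a], so the linear terms sum over [a] to a multiple of
   [dotv x (\sum_a v a) = 0]. *)
have [k hk] := coshR_enorm_step x.
have vE a : enorm (v a) ^+ 2 <= E.
  by rewrite /E (bigD1 a)//= lerDl sumr_ge0// => i _; exact: sqr_ge0.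
have stepa a : \sum_(s : 'S_n) coshR (enorm (x +
    \sum_(j < n.+1 | (j < m.+1)%N) v (lift_perm ord0 a s j))) <=
    n`!%:R * expR E * (coshR (enorm x) + k * (1 - c) * dotv x (v a)).
  pose w (b : 'I_n) := v (lift a b) + n%:R^-1 *: v a.
  have sumv : \sum_b v (lift a b) = - v a.
    by move: hv; rewrite (bigD1_ord a)//= => /eqP; rewrite addrC addr_eq0 => /eqP.
  have w0 : \sum_b w b = 0.
    have [n0|n0] := posnP n; first by move: (w); rewrite n0 => w'; rewrite big_ord0.
    rewrite big_split/= sumv sumr_const card_ord -scaler_nat scalerA divff ?pnatr_eq0 -?lt0n//.
    by rewrite scale1r addNr.
  have wE : \sum_b enorm (w b) ^+ 2 <= E - enorm (v a) ^+ 2.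
    rewrite (eq_bigr (fun b => enorm (v (lift a b)) ^+ 2 +
      ((2 / n%:R) * dotv (v a) (v (lift a b)) + (enorm (v a) / n%:R) ^+ 2))); last first.
      move=> b _; rewrite enormDsqr enormZ dotvZr ger0_norm ?invr_ge0 ?ler0n// (dotvC (v a)).
      by rewrite exprMn; ring.
    rewrite !big_split/= -mulr_sumr -dotv_sumr sumv dotvNr sumr_const card_ord.
    rewrite -(mulr_natl (_ ^+ 2)).
    rewrite /E (bigD1_ord a)//= [leRHS]addrAC subrr add0r gerDl -enorm_sqr.
    have [->|n0] := posnP n; first by rewrite invr0; lra.
    have -> : 2 / n%:R * - enorm (v a) ^+ 2 + n%:R * (enorm (v a) / n%:R) ^+ 2 =
      - (enorm (v a) ^+ 2 / n%:R) by field; rewrite pnatr_eq0 -lt0n.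
    by rewrite oppr_le0 divr_ge0 ?sqr_ge0 ?ler0n.
  pose h := (1 - c) *: v a.
  have hh : enorm h <= enorm (v a).
    by rewrite enormZ ger0_norm ?ler_piMl ?enorm_ge0//; lra.
  have hva : enorm (v a) <= 1 / 4.
    rewrite -(@ler_pXn2r _ 2)// ?nnegrE ?enorm_ge0//.
    by rewrite (le_trans (vE a))// (le_trans hE)//; lra.
  rewrite (eq_bigr (fun s : 'S_n =>
    coshR (enorm ((x + h) + \sum_(j < n | (j < m)%N) w (s j))))); last first.
    move=> s _; congr (coshR (enorm _)).
    rewrite big_mkcond big_ord_recl /= lift_perm_id -big_mkcond/=.
    rewrite big_split/= [X in _ = _ + (_ + X)](big_ord_narrow (hm : (m <= n)%N)).
    rewrite sumr_const card_ord.
    rewrite -scaler_nat scalerA -addrA; congr (x + _).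
    rewrite [RHS]addrCA -scalerDl subrK scale1r addrC.
    by congr (_ + _); apply: eq_bigr => j _; rewrite lift_perm_lift.
  have wE2 : \sum_b enorm (w b) ^+ 2 <= E - enorm h ^+ 2.
    by rewrite (le_trans wE)// lerB// lerXn2r// nnegrE enorm_ge0.
  have wE3 : \sum_b enorm (w b) ^+ 2 <= 1 / 16.
    by rewrite (le_trans wE2)//; have := sqr_ge0 (enorm h); lra.
  apply: le_trans (IH w (x + h) m hm w0 wE3) _.
  rewrite -!mulrA ler_wpM2l ?ler0n//.
  (* Since [|h| <= |v a|], the energy lost by recentring supplies the factor [expR (- |h|^2)] that
     [coshR_enorm_step] requires. *)
  apply: (@le_trans _ _ (expR E * (expR (- enorm h ^+ 2) * coshR (enorm (x + h))))).
    by rewrite mulrA -expRD ler_wpM2r ?coshR_ge0// ler_expR.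
  rewrite ler_wpM2l ?expR_ge0//; apply: le_trans (hk h _) _; first by rewrite (le_trans hh).
  by rewrite dotvZr.
rewrite big_Sn_lift (le_trans (ler_sum _ (fun a _ => stepa a)))//.
rewrite -mulr_sumr big_split/= -[X in _ + X]mulr_sumr -dotv_sumr hv dotvC dot0v mulr0 addr0.
by rewrite sumr_const card_ord factS natrM -[X in _ * X <= _]mulr_natl; lra.
Qed.

End Reshuffling.

(** Markov's inequality for [coshR], after rescaling by [1 / (4 sqrt W)] to bring the energy down to
    [1/16]. The factor [5/2] combines [expR l / 2 <= coshR l] with [expR (1/16) <= 5/4]. *)
Lemma card_reshuffle_tail (R : realType) d n (v : 'I_n -> 'rV[R]_d) (W l : R) m :
  (m <= n)%N -> \sum_i v i = 0 -> \sum_i enorm (v i) ^+ 2 <= W ->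
  0 <= l ->
  #|[set s : 'S_n | 4 * Num.sqrt W * l < enorm (\sum_(j < n | (j < m)%N) v (s j))]%SET|%:R
    <= 5 / 2 * expR (- l) * n`!%:R :> R.
Proof.
move=> mn v0 vW l0; set B := [set s : 'S_n | _]%SET.
have vi2 i : enorm (v i) ^+ 2 <= W.
  by apply: le_trans vW; rewrite (bigD1 i)//= lerDl sumr_ge0// => j _; exact: sqr_ge0.
have W0 : 0 <= W by apply: le_trans vW; apply: sumr_ge0 => i _; exact: sqr_ge0.
(* If [W = 0] all vectors vanish, and the strict inequality defining [B] never holds. *)
move: W0; rewrite le_eqVlt => /predU1P[W0|W0].
  rewrite (_ : B = finset.set0) ?cards0 ?mulr_ge0 ?expR_ge0//.
  apply/setP => s; rewrite !inE -W0 sqrtr0 mulr0 mul0r big1 ?enorm0 ?ltxx// => j _.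
  apply: enorm_eq0; apply/eqP; rewrite -sqrf_eq0.
  by apply/eqP/le_anti; rewrite sqr_ge0 W0 vi2.
have sW0 : 0 < Num.sqrt W by rewrite sqrtr_gt0.
pose c := (4 * Num.sqrt W)^-1.
have c0 : 0 < c by rewrite invr_gt0 mulr_gt0.
pose u i := c *: v i.
have u0 : \sum_i u i = 0 by rewrite -scaler_sumr v0 scaler0.
have uE : \sum_i enorm (u i) ^+ 2 <= 1 / 16.
  under eq_bigr => i _ do rewrite enormZ exprMn real_normK ?num_real//.
  rewrite -mulr_sumr /c invfM exprMn !exprVn sqr_sqrtr ?(ltW W0)//.
  have hW : (\sum_i enorm (v i) ^+ 2) / W <= 1 by rewrite ler_pdivrMr// mul1r.
  rewrite -mulrA (mulrC W^-1); have -> : (4 : R) ^- 2 = 1 / 16 by field.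
  lra.
have := sum_coshR_reshuffle (0 : 'rV[R]_d) mn u0 uE.
rewrite enorm0 coshR0 mulr1 => h.
have hB : #|B|%:R * (expR l / 2) <=
    \sum_(s : 'S_n) coshR (enorm (0 + \sum_(j < n | (j < m)%N) u (s j))).
  rewrite (bigID (mem B))/= -[leLHS]addr0 lerD//; last first.
    by apply: sumr_ge0 => s _; exact: coshR_ge0.
  rewrite -sum1_card natr_sum mulr_suml; apply: ler_sum => s; rewrite inE => hs.
  rewrite mul1r add0r -scaler_sumr enormZ gtr0_norm//.
  apply: le_trans (le_expR_coshR _); rewrite ler_pM2r ?invr_gt0// ler_expR.
  by rewrite /c mulrC ler_pdivlMr ?mulr_gt0// mulrC ltW.
have e16 : expR (1 / 16 : R) <= 16 / 15.
  have := expR_ge1Dx (- (1 / 16) : R); rewrite expRN => h1.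
  have e0 := expR_gt0 (1 / 16 : R).
  by have := ler_wpM2r (ltW e0) h1; rewrite mulVf ?gt_eqF//; lra.
have hE : expR (\sum_i enorm (u i) ^+ 2) <= 5 / 4.
  by apply: (@le_trans _ _ (expR (1 / 16))); [rewrite ler_expR | lra].
have h2 : #|B|%:R * (expR l / 2) <= n`!%:R * (5 / 4).
  by apply: le_trans hB (le_trans h _); rewrite ler_wpM2l ?ler0n.
rewrite expRN -[leRHS]mulrAC ler_pdivlMr ?expR_gt0//; lra.
Qed.

(** Union bound over the prefixes of length [m < n], which are those that drive the inner iterates
    entering [g]. *)
Lemma card_reshuffle_max_tail (R : realType) d n (v : 'I_n -> 'rV[R]_d) (W l : R) :
  \sum_i v i = 0 -> \sum_i enorm (v i) ^+ 2 <= W -> 0 <= l ->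
  #|[set s : 'S_n | [exists m : 'I_n,
      4 * Num.sqrt W * l < enorm (\sum_(j < n | (j < m)%N) v (s j))]]%SET|%:R
    <= 5 / 2 * n%:R * expR (- l) * n`!%:R :> R.
Proof.
move=> v0 vW l0.
pose B m := [set s : 'S_n | 4 * Num.sqrt W * l < enorm (\sum_(j < n | (j < m)%N) v (s j))]%SET.
rewrite (_ : [set s | _]%SET = (\bigcup_(m : 'I_n) B m)%SET); last first.
  apply/setP => s; rewrite inE; apply/existsP/finset.bigcupP => [[m hm]|[m _ hm]].
    by exists m; rewrite // inE.
  by exists m; move: hm; rewrite inE.
apply: (@le_trans _ _ (\sum_(m < n) #|B m|%:R)).
  rewrite -natr_sum ler_nat; elim/big_rec2: _ => [|m p A _ h]; first by rewrite cards0.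
  by rewrite (leq_trans (leq_card_setU _ _))// leq_add2l.
apply: (@le_trans _ _ (\sum_(m < n) (5 / 2 * expR (- l) * n`!%:R))).
  by apply: ler_sum => m _; apply: card_reshuffle_tail => //; exact: ltnW.
by rewrite sumr_const card_ord -mulr_natl; lra.
Qed.

(** * Events determined by finitely many permutations *)

Section Sampling.
Context {R : realType} {dT : measure_display} {T : measurableType dT}
  {P : probability T R} {n : nat} {perms : nat -> T -> 'S_n}.
Hypothesis hs : rr_sampling P perms.

Let fibre t (h : {ffun 'I_t -> 'S_n}) : set T := [set w | forall u : 'I_t, perms u w = h u].

Let measurable_fibre t (h : {ffun 'I_t -> 'S_n}) : measurable (fibre h).
Proof.
rewrite (_ : fibre h = \bigcap_(u in [set: 'I_t]) (perms u @^-1` [set h u])).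
  apply: fin_bigcap_measurable; first exact: finite_finset.
  by move=> u _; have [h1 _ _] := hs; exact: h1.
by apply/seteqP; split=> w /= hw u => [_|]; [exact: hw|exact: (hw u I)].
Qed.

(** There are finitely many histories of length [t], so the event is a finite union of fibres. *)
Lemma measurable_cylinder t (H : set ('I_t -> 'S_n)) :
  measurable [set w | H (fun u : 'I_t => perms u w)].
Proof.
rewrite (_ : [set w | _] = \bigcup_(h in [set h : {ffun 'I_t -> 'S_n} | H h]) fibre h).
  by apply: fin_bigcup_measurable => //; exact: finite_finset.
apply/seteqP; split=> w /=.
  move=> hw; exists [ffun u : 'I_t => perms u w]; last by move=> u; rewrite ffunE.
  by rewrite /= (_ : (fun_of_fin _ : 'I_t -> 'S_n) = fun u : 'I_t => perms u w)//;
    apply/funext => u; rewrite ffunE.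
move=> [h /= Hh hw].
by rewrite (_ : (fun u : 'I_t => perms u w) = h)//; apply/funext => u; exact: hw.
Qed.

Lemma prob_finite_partition (I : finType) (X : T -> I) (A : set T) :
  (forall i, measurable (X @^-1` [set i])) -> measurable A ->
  P A = (\sum_(i : I) P (A `&` X @^-1` [set i]))%E.
Proof.
move=> mX mA.
rewrite [in LHS](_ : A = \bigcup_(i in [set` (predT : pred I)]) (A `&` X @^-1` [set i]));
  last first.
  by apply/seteqP; split=> [w Aw|w [i _ []]]//; exists (X w).
rewrite measure_fin_bigcup.
- by rewrite (bigfs _ (r := index_enum I))// ?index_enum_uniq// => i _; rewrite mem_index_enum.
- exact: finite_finset.
- by move=> i j _ _ [w [[_ /= <-] [_ /= <-]]].
- by move=> i _; exact: measurableI.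
Qed.

Lemma prob_perm t (S : {set 'S_n}) :
  P (perms t @^-1` [set` S]) = (#|S|%:R / n`!%:R : R)%:E.
Proof.
have [h1 h2 _] := hs.
rewrite (prob_finite_partition (X := perms t) (fun i => h1 t [set i])) //.
rewrite (bigID (fun s => s \in S)) /=.
rewrite [X in (_ + X)%E]big1 ?adde0 => [|s sS]; last first.
  rewrite (_ : _ `&` _ = set0) ?measure0// -subset0 => w [/= ws wE].
  by move: sS; rewrite -wE ws.
rewrite (eq_bigr (fun=> ((n`!)%:R^-1 : R)%:E)) => [|s sS].
  by rewrite sumEFin sumr_const mulr_natl.
rewrite -(h2 t s); congr (P _); apply/seteqP; split=> w /= => [[]//|ws].
by split=> //; rewrite ws.
Qed.

(** The bad set may depend on the past. On each fixed history it is constant, so independence bounds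
    its share by [q] times the probability of that history; the histories then sum to [1]. *)
Lemma prob_bad_le t (Bad : ('I_t -> 'S_n) -> {set 'S_n}) (q : R) :
  (forall h, #|Bad h|%:R <= q * n`!%:R :> R) ->
  (P [set w | perms t w \in Bad (fun u : 'I_t => perms u w)] <= q%:E)%E.
Proof.
move=> hq; have [h1 h2 h3] := hs.
pose X w := [ffun u : 'I_t => perms u w].
have XE w : X w = (fun u : 'I_t => perms u w) :> ('I_t -> 'S_n).
  by apply/funext => u; rewrite ffunE.
have mX h : measurable (X @^-1` [set h]).
  rewrite (_ : _ @^-1` _ = fibre h)//.
  by apply/seteqP; split=> w /= => [<- u|hw]; [rewrite ffunE|apply/ffunP => u; rewrite ffunE].
have pastE h : X @^-1` [set h] =
    [set w | (fun g : 'I_t -> 'S_n => g = h) (fun u : 'I_t => perms u w)].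
  apply/seteqP; split=> w /= => [<-|hw]; first by rewrite XE.
  by apply/ffunP => u; rewrite ffunE -hw.
rewrite (prob_finite_partition (X := X))//; last first.
  have := measurable_cylinder (fun g : 'I_t.+1 -> 'S_n =>
    g ord_max \in Bad (fun u : 'I_t => g (widen_ord (leqnSn t) u))).
  exact.
apply: (@le_trans _ _ (\sum_(h : {ffun 'I_t -> 'S_n}) P (X @^-1` [set h]) * q%:E)%E).
  apply: lee_sum => h _.
  rewrite (_ : _ `&` _ = X @^-1` [set h] `&` perms t @^-1` [set` Bad h]); last first.
    by apply/seteqP; split=> w /= [a b]; split=> //; move: a b; rewrite -?XE => + + //; 
     [move=> + <- | move=> <-].
  rewrite pastE (h3 t (fun g => g = h) [set` Bad h]) -pastE lee_wpmul2l//.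
  by rewrite prob_perm lee_fin ler_pdivrMr ?hq.
rewrite -ge0_sume_distrl// -[X in (X * _)%E](_ : 1%E = _) ?mul1e//.
rewrite -(@probability_setT _ _ _ P) (prob_finite_partition (X := X))//.
by apply: eq_bigr => h _; rewrite setTI.
Qed.

End Sampling.

(** * Smooth functions *)

Section Smoothness.
Context {R : realType} {d : nat}.
Implicit Types (h : 'rV[R]_d -> R) (x v : 'rV[R]_d).

Lemma derive_dotv_grad h x v : differentiable (h : 'rV[R]_d -> R^o) x ->
  'D_v (h : 'rV[R]_d -> R^o) x = dotv (grad h x) v.
Proof.
move=> dh; rewrite deriveE// {1}(row_sum_delta v) linear_sum /dotv.
by apply: eq_bigr => j _; rewrite linearZ /= mxE deriveE// mulrC.
Qed.

Lemma is_derive_along_line h x v (t : R) : differentiable (h : 'rV[R]_d -> R^o) (x + t *: v) ->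
  is_derive t (1 : R) (fun s : R => h (x + s *: v) : R^o) (dotv (grad h (x + t *: v)) v).
Proof.
move=> dh; rewrite -derive_dotv_grad//.
have qE : (fun s : R => s^-1 *: (((fun s : R => h (x + s *: v) : R^o) \o shift t) (s *: (1 : R))
      - (h (x + t *: v) : R^o))) =
    (fun s : R =>
      s^-1 *: (((h : 'rV[R]_d -> R^o) \o shift (x + t *: v)) (s *: v) - h (x + t *: v))).
  apply/funext => s /=; congr (_ *: (h _ - _)).
  by rewrite scalerDl -scalerA scale1r addrCA.
have dv : derivable (h : _ -> R^o) (x + t *: v) v by exact: diff_derivable.
by apply: DeriveDef; [rewrite /derivable qE; exact: dv | rewrite /derive qE].
Qed.

(** Mean value theorem on [[0, 1]] for [h] along the segment minus its quadratic model; the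
    Lipschitz bound and Cauchy-Schwarz make the derivative nonpositive. *)
Lemma descent_lemma (L : R) h : (forall x, differentiable (h : 'rV[R]_d -> R^o) x) ->
  lipschitz_grad L h -> forall x v,
  h (x + v) <= h x + dotv (grad h x) v + L / 2 * enorm v ^+ 2.
Proof.
move=> dh lh x v; set c := dotv (grad h x) v; pose k := L / 2 * enorm v ^+ 2.
pose dpsi (t : R) := dotv (grad h (x + t *: v)) v - (c + k * (2 * t)).
pose psi (t : R) : R := h (x + t *: v) - (c * t + k * t ^+ 2).
have hpsi (t : R) : is_derive t (1 : R) psi (dpsi t).
  have h1 := is_derive_along_line (dh (x + t *: v)).
  have h2 : is_derive t (1 : R) (fun t : R => c * t + k * t ^+ 2 : R) (c + k * (2 * t)).
    have hid := is_derive_id t (1 : R).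
    have h3 := is_deriveZ c hid.
    have h4 := is_deriveZ k (is_deriveX 2 hid).
    have h5 := is_deriveD h3 h4.
    apply: is_derive_eq h5 _.
    rewrite /= scaler1 /GRing.scale /= !mulr1 expr1; ring.
  exact: is_deriveB h1 h2.
have cpsi : {within `[0, 1], continuous psi}.
  apply: continuous_subspaceT => t; apply: differentiable_continuous.
  by apply/derivable1_diffP; exact: ex_derive.
have [c0 /itvP c01] := MVT ltr01 (fun t _ => hpsi t) cpsi.
rewrite subr0 mulr1 /psi scale1r scale0r addr0 mulr0 expr0n /=.
rewrite !mulr0 !mulr1 expr1n mulr1 addr0 subr0.
suff : dpsi c0 <= 0 by rewrite /k; lra.
rewrite /dpsi opprD addrA -dotvNl -dotvDl subr_le0.
apply: le_trans (dotv_le _ _) _.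
have := lh (x + c0 *: v) x.
rewrite addrAC subrr add0r enormZ ger0_norm ?c01// => h1.
apply: le_trans (ler_wpM2r (enorm_ge0 v) h1) _.
by rewrite /k expr2; lra.
Qed.

(** A gradient step of length [1 / L] lowers [h] by at least [|grad h|^2 / (2 L)] and cannot go
    below [b]. *)
Lemma sqr_grad_le (L b : R) h : 0 < L -> (forall x, differentiable (h : 'rV[R]_d -> R^o) x) ->
  lipschitz_grad L h -> (forall x, b <= h x) -> forall x,
  enorm (grad h x) ^+ 2 <= 2 * L * (h x - b).
Proof.
move=> L0 dh lh hb x.
have := descent_lemma dh lh x (- L^-1 *: grad h x).
rewrite dotvZr -enorm_sqr enormZ normrN ger0_norm ?invr_ge0 ?(ltW L0)//.
set G := enorm _; move=> h1.
have := le_trans (hb _) h1.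
have -> : L / 2 * (L^-1 * G) ^+ 2 = L^-1 * G ^+ 2 / 2 by field; rewrite gt_eqF.
move=> h2; have h3 : 0 <= h x - b - L^-1 * G ^+ 2 / 2 by lra.
have := mulr_ge0 (ltW L0) h3; rewrite mulrBr !mulrA divff ?gt_eqF// mul1r; lra.
Qed.

Lemma grad_favg n (f : 'I_n -> 'rV[R]_d -> R) x :
  (forall i, differentiable (f i : 'rV[R]_d -> R^o) x) ->
  grad (favg f) x = n%:R^-1 *: \sum_i grad (f i) x.
Proof.
move=> df; apply/rowP => j; rewrite !mxE summxE.
have -> : (favg f : 'rV[R]_d -> R^o) =
    (n%:R^-1 : R) \*: (\sum_(i < n) (f i : 'rV[R]_d -> R^o)).
  by apply/funext => y; rewrite /favg /= fct_sumE.
have di i : derivable (f i : 'rV[R]_d -> R^o) x (delta_mx 0 j) by exact: diff_derivable.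
rewrite deriveZ; last exact: derivable_sum.
rewrite derive_sum//; congr (_ * _); apply: eq_bigr => i _.
by rewrite mxE.
Qed.

Lemma differentiable_favg n (f : 'I_n -> 'rV[R]_d -> R) x :
  (forall i, differentiable (f i : 'rV[R]_d -> R^o) x) ->
  differentiable (favg f : 'rV[R]_d -> R^o) x.
Proof.
move=> df.
have -> : (favg f : 'rV[R]_d -> R^o) =
    (n%:R^-1 : R) \*: (\sum_(i < n) (f i : 'rV[R]_d -> R^o)).
  by apply/funext => y; rewrite /favg /= fct_sumE.
by apply: differentiableZ; exact: differentiable_sum.
Qed.

Lemma lipschitz_grad_favg (L : R) n (f : 'I_n -> 'rV[R]_d -> R) : (0 < n)%N ->
  (forall i x, differentiable (f i : 'rV[R]_d -> R^o) x) ->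
  (forall i, lipschitz_grad L (f i)) -> lipschitz_grad L (favg f).
Proof.
move=> n0 df lf x y; rewrite !grad_favg// -scalerBr -sumrB enormZ.
have n0' : 0 < n%:R :> R by rewrite ltr0n.
rewrite ger0_norm ?invr_ge0 ?ler0n// ler_pdivrMl//.
apply: le_trans (ler_enorm_sum _ _ _) _.
apply: le_trans (ler_sum _ (fun i _ => lf i x y)) _.
by rewrite sumr_const card_ord mulr_natl.
Qed.

End Smoothness.

(** * One epoch *)

Lemma big_ord_lt_recr (V : nmodType) n (F : 'I_n -> V) i (hi : (i < n)%N) :
  \sum_(j < n | (j < i.+1)%N) F j = \sum_(j < n | (j < i)%N) F j + F (Ordinal hi).
Proof.
rewrite (bigD1 (Ordinal hi)) /= ?ltnSn// addrC; congr (_ + _).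
by apply: eq_bigl => j; rewrite -val_eqE /= ltnS ltn_neqAle andbC.
Qed.

Lemma sum_ord_le (R : realType) n : \sum_(i < n) (i%:R : R) <= n%:R ^+ 2 / 2.
Proof.
elim: n => [|n IH]; first by rewrite big_ord0 expr0n mul0r.
rewrite big_ord_recr/= -natr1; move: IH; set S := \sum_(i < n) _; set k : R := n%:R.
by move=> IH; have : 0 <= k by []; lra.
Qed.

Section Epoch.
Context {R : realType} {n d : nat}.
Variables (f : 'I_n -> 'rV[R]_d -> R) (L a : R) (s : 'S_n) (x : 'rV[R]_d).
Hypotheses (n0 : (0 < n)%N) (L0 : 0 < L) (a0 : 0 <= a) (anL : a * n%:R * L <= 1 / 4).
Hypothesis df : forall i x, differentiable (f i : 'rV[R]_d -> R^o) x.
Hypothesis lf : forall i, lipschitz_grad L (f i).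

Let y := rr_inner f a s x.
Let g := n%:R^-1 *: \sum_(i < n) grad (f (s i)) (y i).
Let gx := grad (favg f) x.

Lemma rr_innerE i : (i <= n)%N ->
  y i = x - a *: \sum_(j < n | (j < i)%N) grad (f (s j)) (y j).
Proof.
elim: i => [|i IH] hi; first by rewrite big_pred0 ?scaler0 ?subr0// => j; rewrite ltn0.
rewrite (big_ord_lt_recr _ hi) scalerDr opprD addrA -IH ?(ltnW hi)//.
by rewrite {1}/y /= insubT.
Qed.

Lemma rr_inner_epoch : y n = x - (a * n%:R) *: g.
Proof.
rewrite rr_innerE// scalerA mulfK ?pnatr_eq0 -?lt0n//.
by congr (_ - _ *: _); apply: eq_bigl => j; rewrite ltn_ord.
Qed.

Lemma avg_grad_perm : n%:R^-1 *: \sum_(i < n) grad (f (s i)) x = gx.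
Proof.
rewrite /gx grad_favg//; congr (_ *: _).
by rewrite [RHS](reindex_inj (@perm_inj _ s)).
Qed.

(** With [S] the sum of the drifts [|y i - x|], each drift is at most [a (L S + D + i G)]. After
    summation [a n L <= 1/4] absorbs the [S] on the right, and [|g - gx| <= L S / n] concludes. *)
Lemma epoch_error (D : R) :
  (forall m : 'I_n, enorm (\sum_(j < n | (j < m)%N) (grad (f (s j)) x - gx)) <= D) ->
  enorm (g - gx) <= 4 / 3 * (a * L * D) + enorm gx / 6.
Proof.
move=> hD; have nR : 0 < n%:R :> R by rewrite ltr0n.
pose e (i : 'I_n) := enorm (y i - x).
pose S := \sum_i e i.
have e0 i : 0 <= e i by exact: enorm_ge0.
have S0 : 0 <= S by exact: sumr_ge0.
set G := enorm gx; have G0 : 0 <= G by exact: enorm_ge0.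
have he (i : 'I_n) : e i <= a * (L * S + D + i%:R * G).
  rewrite /e rr_innerE ?(ltnW (ltn_ord i))// addrAC subrr add0r enormN enormZ ger0_norm//.
  apply: ler_wpM2l => //.
  (* Each gradient splits into a Lipschitz drift term, a centred term controlled by [D], and the
     mean [gx]. *)
  rewrite (eq_bigr (fun j : 'I_n => (grad (f (s j)) (y j) - grad (f (s j)) x) +
    ((grad (f (s j)) x - gx) + gx))) => [|j _]; last by rewrite subrK subrK.
  rewrite big_split/= [X in _ + X]big_split/= addrA.
  apply: le_trans (ler_enormD _ _) _; apply: lerD; last first.
    rewrite (big_ord_narrow (ltnW (ltn_ord i))) sumr_const card_ord -scaler_nat enormZ.
    by rewrite ger0_norm ?ler0n.
  apply: le_trans (ler_enormD _ _) _; apply: lerD => //.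
  apply: le_trans (ler_enorm_sum _ _ _) _.
  rewrite /S mulr_sumr [leRHS](bigID (fun j : 'I_n => (j < i)%N))/=.
  rewrite -[leLHS]addr0 lerD//; last by apply: sumr_ge0 => j _; apply: mulr_ge0 (ltW L0) (e0 j).
  by apply: ler_sum => j _; exact: lf.
have hS : S <= n%:R * (a * (L * S + D)) + a * G * (n%:R ^+ 2 / 2).
  apply: le_trans (ler_sum _ (fun i _ => he i)) _.
  rewrite (eq_bigr (fun i : 'I_n => a * (L * S + D) + (a * G) * i%:R)) => [|i _]; last by ring.
  rewrite big_split/= sumr_const card_ord -[X in X + _]mulr_natl -mulr_sumr lerD2l.
  by apply: ler_wpM2l; [rewrite mulr_ge0|exact: sum_ord_le].
have hg : enorm (g - gx) <= L * S / n%:R.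
  rewrite -avg_grad_perm /g -scalerBr -sumrB enormZ ger0_norm ?invr_ge0 ?ler0n//.
  rewrite mulrC ler_pM2r ?invr_gt0//.
  apply: le_trans (ler_enorm_sum _ _ _) _.
  by rewrite /S mulr_sumr; apply: ler_sum => j _; exact: lf.
apply: le_trans hg _; rewrite ler_pdivrMr//.
move: hS anL; set k : R := n%:R in nR * => hS h4.
have h1 : a * k * L * S <= 1 / 4 * S by exact: ler_wpM2r.
have h2 : 3 / 4 * S <= k * a * D + a * G * k ^+ 2 / 2 by lra.
have h3 : L * (3 / 4 * S) <= L * (k * a * D + a * G * k ^+ 2 / 2) by rewrite ler_pM2l.
have h5 : (a * k * L) * (G * k) <= 1 / 4 * (G * k).
  by apply: ler_wpM2r => //; rewrite mulr_ge0// ltW.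
lra.
Qed.

Lemma epoch_dichotomy (thr D : R) : 0 < thr ->
  (forall m : 'I_n, enorm (\sum_(j < n | (j < m)%N) (grad (f (s j)) x - gx)) <= D) ->
  a * L * D <= 3 / 10 * thr ->
  (enorm g <= thr -> enorm gx <= Num.sqrt (28%:R / 9%:R) * thr) /\
  (thr < enorm g -> favg f (y n) <= favg f x - a * n%:R * (thr ^+ 2 / 5)).
Proof.
move=> t0 hD hq; have he := epoch_error hD.
set q := a * L * D in hq he; set e := enorm (g - gx) in he.
set G := enorm gx in he *.
have G0 : 0 <= G by exact: enorm_ge0.
have e0 : 0 <= e by exact: enorm_ge0.
split=> hg.
  have hG : G <= enorm g + e.
    by rewrite /G -[gx](subKr g) ler_enormB.
  rewrite -(@ler_pXn2r _ 2)// ?nnegrE ?mulr_ge0 ?sqrtr_ge0// ?(ltW t0)//.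
  rewrite exprMn (@sqr_sqrtr _ (28 / 9)) ?divr_ge0 ?ler0n//.
  (* From [G <= thr + (4/10) thr + G / 6], that is [G <= 1.68 thr]; and [1.7 ^ 2 = 2.89 < 28/9]. *)
  have : G <= 17 / 10 * thr by lra.
  move=> h; apply: (@le_trans _ _ ((17 / 10 * thr) ^+ 2)).
    by apply: lerXn2r => //; rewrite nnegrE mulr_ge0 ?(ltW t0).
  rewrite exprMn ler_wpM2r ?sqr_ge0//; lra.
rewrite rr_inner_epoch -scaleNr.
have lF := lipschitz_grad_favg n0 df lf.
have dF z : differentiable (favg f : 'rV[R]_d -> R^o) z by exact: differentiable_favg.
apply: le_trans (descent_lemma dF lF x _) _.
set b := a * n%:R; have b0 : 0 <= b by rewrite mulr_ge0// ler0n.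
rewrite dotvZr enormZ normrN ger0_norm// -/gx.
(* Polarisation: the decrease is at least [b / 2] times [G^2 + (3/4) |g|^2 - e^2], hence at least
   [b / 2 * (0.75 - 0.32) thr^2], which exceeds [b thr^2 / 5]. *)
have hdot : 2 * dotv gx g = G ^+ 2 + enorm g ^+ 2 - e ^+ 2.
  rewrite /e (enormBsqr g gx) (dotvC gx) -/G; ring.
have he2 : e ^+ 2 <= 32 / 100 * thr ^+ 2 + G ^+ 2 / 18.
  apply: (@le_trans _ _ ((4 / 10 * thr + G / 6) ^+ 2)).
    by rewrite lerXn2r// ?nnegrE//; [rewrite addr_ge0 ?mulr_ge0 ?(ltW t0) | lra].
  have := sqr_ge0 (4 / 10 * thr - G / 6); lra.
have hg2 : thr ^+ 2 <= enorm g ^+ 2 by rewrite lerXn2r ?nnegrE ?enorm_ge0 ?(ltW t0) ?(ltW hg).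
have h1 : (b * L) * (b * enorm g ^+ 2) <= 1 / 4 * (b * enorm g ^+ 2).
  apply: ler_wpM2r => //; apply: mulr_ge0 => //; exact: sqr_ge0.
have h2 : 0 <= b * (G ^+ 2 * (17 / 18) + enorm g ^+ 2 * (3 / 4) -
    32 / 100 * thr ^+ 2 - 2 / 5 * thr ^+ 2).
  by apply: mulr_ge0 => //; have := sqr_ge0 G; have := sqr_ge0 thr; lra.
have h3 : b * e ^+ 2 <= b * (32 / 100 * thr ^+ 2 + G ^+ 2 / 18) by exact: ler_wpM2l.
have h4 : b * (2 * dotv gx g) = b * (G ^+ 2 + enorm g ^+ 2 - e ^+ 2) by rewrite hdot.
lra.
Qed.

End Epoch.

(** * Blocks and step sizes *)

Lemma blockTS k : blockT k.+1 = (blockT k + blockS k)%N.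
Proof. by rewrite /blockT big_nat_recr. Qed.

Lemma blockT_expn k : (blockT k).+1 = (2 ^ k)%N.
Proof.
elim: k => [|k IH]; first by rewrite /blockT big_geq.
by rewrite blockTS -addSn IH /blockS addnn -mul2n expnS.
Qed.

(** Block [k] consists of the [t] with [2 ^ k <= t + 1 < 2 ^ (k + 1)]. *)
Definition block_index (t : nat) : nat := trunc_log 2 t.+1.

Lemma block_indexP t :
  (blockT (block_index t) <= t < blockT (block_index t) + blockS (block_index t))%N.
Proof.
rewrite -blockTS -ltnS -[(t < _)%N]ltnS !blockT_expn.
by rewrite trunc_logP//= trunc_log_ltn.
Qed.

Lemma block_index_eq k t : (blockT k <= t < blockT k + blockS k)%N -> block_index t = k.
Proof.
rewrite -blockTS -ltnS -[(t < _)%N]ltnS !blockT_expn => h.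
exact: trunc_log_eq.
Qed.

Lemma big_blocks (V : nmodType) (q : nat -> V) K :
  \sum_(0 <= t < blockT K) q (block_index t) = \sum_(0 <= k < K) q k *+ blockS k.
Proof.
elim: K => [|K IH]; first by rewrite /blockT !big_geq// big_geq.
rewrite big_nat_recr//= -IH blockTS (big_cat_nat (leq0n _) (leq_addr _ _))/=.
congr (_ + _); rewrite (eq_big_nat _ _ (F2 := fun=> q K)) => [|t /block_index_eq ->//].
by rewrite sumr_const_nat addKn.
Qed.

Section StepSizes.
Context {R : realType}.

Lemma ln_le_id (y : R) : 0 < y -> ln y <= y.
Proof. by move=> y0; rewrite ltW// ln_sublinear. Qed.

(** Telescoping: the induction runs on the sharper bound [2 - 1 / K], for [K > 0]. *)
Lemma sum_inv_sqr_le K : \sum_(0 <= k < K) (k.+1%:R ^+ 2)^-1 <= 2 :> R.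
Proof.
case: K => [|K]; first by rewrite big_geq.
apply: (@le_trans _ _ (2 - K.+1%:R^-1)); last by rewrite gerBl.
elim: K => [|K IH]; first by rewrite big_nat1 expr1n invr1; lra.
rewrite big_nat_recr//=; apply: le_trans (lerD IH (lexx _)) _.
set a : R := K.+1%:R; have a0 : 0 < a by rewrite ltr0n.
have -> : K.+2%:R = a + 1 :> R by rewrite -natr1.
rewrite -addrA lerD2l addrC lerBlDr.
have -> : - (a + 1)^-1 + a^-1 = (a * (a + 1))^-1 by field; rewrite !gt_eqF//; lra.
rewrite lef_pV2 ?posrE ?exprn_gt0 ?mulr_gt0//; nra.
Qed.

(** At [k = 2 i] the power is [(2 ^ i) ^ 2 >= (i + 1) ^ 2], a square that beats the linear term once
    [i > |a| + 2 |b|]. *)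
Lemma linear_lt_expn (a b : R) : exists k : nat, a + b * k%:R < 2 ^+ k.
Proof.
pose i := Num.bound (`|a| + 2 * `|b|); exists (i + i)%N.
have hi : `|a| + 2 * `|b| < i%:R by apply: archi_boundP; rewrite addr_ge0 ?mulr_ge0.
have h2 : i%:R + 1 <= 2 ^+ i :> R by rewrite natr1 -natrX ler_nat ltn_expl.
have i0 : 0 <= i%:R :> R by exact: ler0n.
rewrite exprD natrD; apply: (@lt_le_trans _ _ ((i%:R + 1) * (i%:R + 1))); last first.
  by rewrite ler_pM ?addr_ge0.
have := ler_norm a; have := ler_norm b; have := normr_ge0 a; have := normr_ge0 b.
set r : R := i%:R in hi i0 *.
move: hi; set A := `|a|; set B := `|b| => hi B0 A0 bB aA.
have h3 : b * (r + r) <= B * (r + r) by apply: ler_wpM2r => //; lra.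
have h4 : (A + 2 * B) * (r + 1) <= r * (r + 1) by apply: ler_wpM2r; lra.
have h5 := mulr_ge0 A0 i0.
lra.
Qed.

Section WithParameters.
Variables (n : nat) (delta : R).
Hypotheses (n0 : (0 < n)%N) (delta0 : 0 < delta) (delta1 : delta < 1).

Let nR : 1 <= n%:R :> R. Proof. by rewrite ler1n. Qed.

Let pi2 : 4 <= (pi : R) ^+ 2.
Proof. by have := @pi_ge2 R; nra. Qed.

Lemma delta_sc_gt0 k : 0 < delta_sc delta k.
Proof. by rewrite /delta_sc divr_gt0 ?mulr_gt0 ?exprn_gt0 ?pi_gt0 ?ltr0n. Qed.

(** Uses only [pi ^+ 2 >= 4] and [sum_inv_sqr_le]; the slack is affordable because [tail_budget]
    spends [5/16] of each [delta_k]. *)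
Lemma sum_delta_sc K : \sum_(0 <= k < K) delta_sc delta k <= 3 * delta.
Proof.
apply: (@le_trans _ _ (\sum_(0 <= k < K) (3 / 2 * delta) * (k.+1%:R ^+ 2)^-1)).
  apply: ler_sum => k _; rewrite /delta_sc invfM mulrA.
  apply: ler_wpM2r; first by rewrite invr_ge0 exprn_ge0.
  have p2 := pi2; rewrite ler_pdivrMr; last by lra.
  by have := ler_wpM2l (ltW delta0) p2; lra.
rewrite -mulr_sumr; apply: (@le_trans _ _ (3 / 2 * delta * 2)); last lra.
apply: ler_wpM2l (sum_inv_sqr_le K). by rewrite mulr_ge0 ?(ltW delta0)//.
Qed.

Lemma ell_arg_ge k : 1 < 8 * n%:R * (blockS k)%:R / delta_sc delta k.
Proof.
have S1 : 1 <= (blockS k)%:R :> R by rewrite ler1n expn_gt0.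
have k1 : 1 <= k.+1%:R ^+ 2 :> R by rewrite -natrX ler1n expn_gt0.
have d0 := delta0; have d1 := delta1; have p2 := pi2; have n1 := nR.
rewrite ltr_pdivlMr ?delta_sc_gt0// mul1r.
apply: (@le_lt_trans _ _ (3 / 2)).
  rewrite /delta_sc ler_pdivrMr; last by nra.
  nra.
nra.
Qed.

Lemma ell_sc_gt0 k : 0 < ell_sc n delta k.
Proof. by rewrite /ell_sc ln_gt0// ell_arg_ge. Qed.

(** [expR (- ell_k) = delta_k / (8 n S_k)] cancels the [n] prefixes of each of the [S_k] epochs and
    leaves [(5/2) / 8]. *)
Lemma tail_budget k :
  (blockS k)%:R * (5 / 2 * n%:R * expR (- ell_sc n delta k)) = 5 / 16 * delta_sc delta k.
Proof.
rewrite /ell_sc expRN lnK ?posrE ?(lt_trans ltr01 (ell_arg_ge k))//.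
have S1 : (blockS k)%:R != 0 :> R by rewrite pnatr_eq0 -lt0n expn_gt0.
by field; rewrite S1 !gt_eqF ?delta_sc_gt0 ?(lt_le_trans ltr01 nR).
Qed.

(** The logarithm splits into [ln (8 pi^2 / 6) + ln n + ln (1 / delta) + k ln 2 + 2 ln (k + 1)], and
    the last two terms are at most [3 k]. *)
Lemma ell_sc_le k :
  ell_sc n delta k <= 8 * pi ^+ 2 / 6 + ln n%:R + ln (1 / delta) + 3 * k%:R.
Proof.
have p0 : 0 < 8 * (pi : R) ^+ 2 / 6 by rewrite divr_gt0 ?mulr_gt0 ?exprn_gt0 ?pi_gt0.
move: p0; move PE : (8 * pi ^+ 2 / 6) => P p0.
have n0' : 0 < n%:R :> R by rewrite ltr0n.
have k0 : 0 < k.+1%:R :> R by rewrite ltr0n.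
have -> : ell_sc n delta k = ln P + ln n%:R + ln (1 / delta) +
   (ln 2 *+ k + ln k.+1%:R *+ 2).
  rewrite -!lnXn// -!lnM ?posrE ?mulr_gt0 ?invr_gt0 ?exprn_gt0//.
  rewrite -PE /ell_sc /delta_sc /blockS natrX; congr ln.
  by move: (pi_gt0 R); move: pi => q q0; field; rewrite !gt_eqF.
have h1 := ln_le_id p0.
have h2 : ln 2 <= 1 :> R by have := @le_ln1Dx R 1; rewrite (_ : 1 + 1 = 2)//; apply; lra.
have h3 : ln k.+1%:R <= k%:R :> R.
  have := @le_ln1Dx R k%:R; rewrite -natr1 addrC; apply; have : 0 <= k%:R :> R by []; lra.
have h4 : ln 2 *+ k <= k%:R :> R.
  by rewrite -[leLHS]mulr_natr ler_piMl.
rewrite mulr2n; move: h1 h3 h4; set z := ln 2 *+ k; set w := ln k.+1%:R => h1 h3 h4.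
lra.
Qed.

Section WithProblem.
Variables (L F thr : R).
Hypotheses (L0 : 0 < L) (F0 : 0 <= F) (thr0 : 0 < thr).

Let alpha k := alpha_sc n L F thr delta k.

Let cap0 k : 0 < F -> 0 < 8 * Num.sqrt (n%:R * constA L * F) * L * ell_sc n delta k.
Proof.
move=> F1; have n0' : 0 < n%:R :> R by rewrite ltr0n.
by rewrite !mulr_gt0 ?ell_sc_gt0// sqrtr_gt0 !mulr_gt0.
Qed.

Lemma alpha_sc_gt0 k : 0 < alpha k.
Proof.
have n0' : 0 < n%:R :> R by rewrite ltr0n.
have a1 : 0 < 1 / (4 * n%:R * L) by rewrite divr_gt0 ?mulr_gt0.
rewrite /alpha /alpha_sc; case: eqVneq => // F1.
rewrite lt_min a1 divr_gt0// cap0// lt_neqAle eq_sym F1//.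
Qed.

Lemma alpha_sc_le k : alpha k * n%:R * L <= 1 / 4.
Proof.
have n0' : 0 < n%:R :> R by rewrite ltr0n.
have h : alpha k <= 1 / (4 * n%:R * L).
  by rewrite /alpha /alpha_sc; case: eqVneq => // F1; rewrite ge_min lexx.
have := ler_wpM2r (ltW (mulr_gt0 n0' L0)) h.
have -> : 1 / (4 * n%:R * L) * (n%:R * L) = 1 / 4 by field; rewrite !gt_eqF.
by rewrite mulrA.
Qed.

(** The second cap gives [thr / 2] without the factor [sqrt (1/3)], which is at most [3/5]. If
    [F = 0] the left side is zero. *)
Lemma alpha_sc_deviation_le k :
  alpha k * L * (4 * Num.sqrt (n%:R * constA L * F / 3) * ell_sc n delta k) <= 3 / 10 * thr.
Proof.
have n0' : 0 < n%:R :> R by rewrite ltr0n.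
move: F0; rewrite le_eqVlt => /predU1P[<-|F1].
  by rewrite mulr0 mul0r sqrtr0 mulr0 mul0r mulr0 mulr_ge0 ?(ltW thr0)//.
rewrite sqrtrM; last by rewrite !mulr_ge0 ?(ltW F1) ?(ltW L0).
have s3 : Num.sqrt 3^-1 <= 3 / 5 :> R.
  rewrite -(@ler_pXn2r _ 2) ?nnegrE ?sqrtr_ge0 ?divr_ge0//.
  by rewrite sqr_sqrtr; lra.
have h : alpha k <= thr / (8 * Num.sqrt (n%:R * constA L * F) * L * ell_sc n delta k).
  by rewrite /alpha /alpha_sc gt_eqF// ge_min lexx orbT.
have c0 := cap0 k F1.
move: h c0; set s := Num.sqrt (n%:R * _ * F); set l := ell_sc _ _ _; set a := alpha k.
move=> h c0; move: h; rewrite ler_pdivlMr// => h.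
have h2 : (a * (8 * s * L * l)) * Num.sqrt 3^-1 <= thr * (3 / 5).
  apply: ler_pM => //.
  by rewrite mulr_ge0 ?ltW ?alpha_sc_gt0.
lra.
Qed.

(** Each of the two values of the minimum defining [alpha k] accounts for one summand. *)
Lemma block_length_le (Delta : R) k : 0 <= Delta ->
  (blockS k)%:R * (alpha k * n%:R * (thr ^+ 2 / 5)) <= Delta ->
  n%:R * 2 ^+ k <= 20 * L * Delta * (n%:R * thr ^- 2) +
    40 * L * Delta * Num.sqrt (constA L * F) * ell_sc n delta k *
      (Num.sqrt n%:R * thr ^- 3).
Proof.
move=> D0; have n0' : 0 < n%:R :> R by rewrite ltr0n.
have l0 := ell_sc_gt0 k.
have e1 : 0 <= 20 * L * Delta * (n%:R * thr ^- 2).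
  by rewrite !mulr_ge0 ?invr_ge0 ?exprn_ge0 ?(ltW thr0) ?(ltW L0).
have e2 : 0 <= 40 * L * Delta * Num.sqrt (constA L * F) * ell_sc n delta k *
      (Num.sqrt n%:R * thr ^- 3).
  by rewrite !mulr_ge0 ?sqrtr_ge0 ?invr_ge0 ?exprn_ge0 ?(ltW thr0) ?(ltW L0) ?(ltW l0).
rewrite /blockS natrX; set p : R := 2 ^+ k.
have hmin : alpha k = 1 / (4 * n%:R * L) \/
    0 < F /\ alpha k = thr / (8 * Num.sqrt (n%:R * constA L * F) * L * ell_sc n delta k).
  rewrite /alpha /alpha_sc; case: eqVneq => [|F1]; first by left.
  rewrite /Order.min; case: ifP => _; [by left|right].
  by rewrite lt_neqAle eq_sym F1.
case: hmin => [->|[F1 ->]] h.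
  apply: (@le_trans _ _ (20 * L * Delta * (n%:R * thr ^- 2))); last by rewrite lerDl.
  have -> : n%:R * p = 20 * L * n%:R * thr ^- 2 *
     (p * (1 / (4 * n%:R * L) * n%:R * (thr ^+ 2 / 5))).
    by field; rewrite !gt_eqF.
  have -> : 20 * L * Delta * (n%:R * thr ^- 2) = 20 * L * n%:R * thr ^- 2 * Delta by ring.
  by apply: ler_wpM2l h; rewrite !mulr_ge0 ?invr_ge0 ?exprn_ge0 ?(ltW thr0) ?(ltW L0).
apply: (le_trans _ (_ : 40 * L * Delta * Num.sqrt (constA L * F) * ell_sc n delta k *
      (Num.sqrt n%:R * thr ^- 3) <= _)); last by rewrite lerDr.
have sE : Num.sqrt (n%:R * constA L * F) = Num.sqrt n%:R * Num.sqrt (constA L * F).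
  by rewrite -mulrA sqrtrM ?ler0n.
move: h; rewrite sE.
have sn0 : 0 < Num.sqrt (n%:R : R) by rewrite sqrtr_gt0.
have sn2 : Num.sqrt (n%:R : R) ^+ 2 = n%:R by rewrite sqr_sqrtr ?ler0n.
have sA0 : 0 < Num.sqrt (constA L * F) by rewrite sqrtr_gt0 !mulr_gt0.
move: sn0 sn2 sA0 l0 {e1 e2}; set u := Num.sqrt n%:R; set v := Num.sqrt _; set l := ell_sc _ _ _.
move=> u0 u2 v0 l0 h.
have -> : n%:R * p = 40 * L * v * l * u * thr ^- 3 *
    (p * (thr / (8 * (u * v) * L * l) * n%:R * (thr ^+ 2 / 5))).
  by field; rewrite !gt_eqF.
have -> : 40 * L * Delta * v * l * (u * thr ^- 3) = 40 * L * v * l * u * thr ^- 3 * Delta by ring.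
apply: ler_wpM2l h; rewrite !mulr_ge0 ?invr_ge0 ?exprn_ge0 ?(ltW thr0) ?(ltW L0)//.
- exact: ltW v0.
- exact: ltW l0.
- exact: ltW u0.
Qed.

(** Otherwise [2 ^ k] would stay below an affine function of [k]. Such a block bounds the horizon in
    advance, so that the union bound is finite. *)
Lemma exists_long_block (Delta : R) : 0 <= Delta ->
  exists k, Delta < (blockS k)%:R * (alpha k * n%:R * (thr ^+ 2 / 5)).
Proof.
move=> D0; have n0' : 0 < n%:R :> R by rewrite ltr0n.
pose M1 := 20 * L * Delta * (n%:R * thr ^- 2).
pose M2 := 40 * L * Delta * Num.sqrt (constA L * F) * (Num.sqrt n%:R * thr ^- 3).
have M20 : 0 <= M2 by rewrite !mulr_ge0 ?sqrtr_ge0 ?invr_ge0 ?exprn_ge0 ?(ltW thr0) ?(ltW L0).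
pose c := 8 * pi ^+ 2 / 6 + ln n%:R + ln (1 / delta).
have [k hk] := linear_lt_expn (M1 + M2 * c) (M2 * 3).
exists k; rewrite ltNge; apply/negP => /(block_length_le D0).
have h1 : 2 ^+ k <= n%:R * 2 ^+ k :> R by rewrite ler_peMl ?exprn_ge0.
have h2 : M2 * ell_sc n delta k <= M2 * (c + 3 * k%:R).
  by apply: ler_wpM2l => //; exact: ell_sc_le.
rewrite -/M1.
have -> : 40 * L * Delta * Num.sqrt (constA L * F) * ell_sc n delta k *
      (Num.sqrt n%:R * thr ^- 3) = M2 * ell_sc n delta k by rewrite /M2; ring.
lra.
Qed.

End WithProblem.

End WithParameters.

(** * From block lengths to the complexity bound *)

Lemma ln2_ge : 1 / 2 <= ln 2 :> R.
Proof.
rewrite -ler_expR lnK ?posrE//.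
have := expR_ge1Dx (- (1 / 2) : R); rewrite expRN => h1.
have e0 := expR_gt0 (1 / 2 : R).
by have := ler_wpM2r (ltW e0) h1; rewrite mulVf ?gt_eqF//; lra.
Qed.

Definition c_ell : R := 8 * pi ^+ 2 / 6.

Definition block_const (L Delta F : R) : R :=
  20 * L * Delta + 40 * L * Delta * Num.sqrt (constA L * F).

(** Factor such that a block [k] passed without stopping has [k <= index_const * Lam]. *)
Definition index_const (L Delta F : R) : R :=
  4 * (ln (block_const L Delta F + 1) + 16 + c_ell).

(** [F] is rebuilt from [Delta] and [B], so the constant depends only on the permitted
    quantities. *)
Definition rate_const (L Delta B : R) : R :=
  let F := 3 * Delta + 3 * B / constA L in
  4 * block_const L Delta F * (2 + c_ell + 3 * index_const L Delta F).

Section Rate.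
Variables (n : nat) (delta L F thr Delta : R).
Hypotheses (n0 : (0 < n)%N) (delta0 : 0 < delta) (delta1 : delta < 1).
Hypotheses (L0 : 0 < L) (F0 : 0 <= F) (thr0 : 0 < thr) (thr1 : thr <= 1) (D0 : 0 <= Delta).

Let Lam := 1 + ln n%:R + ln (1 / delta) + ln (1 / thr).
Let M := Num.max (n%:R * thr ^- 2) (Num.sqrt n%:R * thr ^- 3).

Let nR : 1 <= n%:R :> R. Proof. by rewrite ler1n. Qed.
Let ln_n : 0 <= ln n%:R :> R. Proof. exact: ln_ge0. Qed.
Let ln_d : 0 <= ln (1 / delta).
Proof. by apply: ln_ge0; rewrite ler_pdivlMr// mul1r ltW. Qed.
Let ln_t : 0 <= ln (1 / thr).
Proof. by apply: ln_ge0; rewrite ler_pdivlMr// mul1r. Qed.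
Let Lam1 : 1 <= Lam.
Proof. by have h1 := ln_n; have h2 := ln_d; have h3 := ln_t; rewrite /Lam; lra. Qed.

Lemma c_ell_ge0 : 0 <= c_ell.
Proof. by rewrite /c_ell divr_ge0 ?mulr_ge0 ?exprn_ge0 ?pi_ge0. Qed.

Lemma block_const_ge0 : 0 <= block_const L Delta F.
Proof. by rewrite addr_ge0 ?mulr_ge0 ?sqrtr_ge0 ?(ltW L0). Qed.

Lemma rate_ge0 :
  0 <= 4 * block_const L Delta F * (2 + c_ell + 3 * index_const L Delta F) * M * Lam.
Proof.
have c0 := c_ell_ge0; have b0 := block_const_ge0; have L1 := Lam1.
have i0 : 0 <= index_const L Delta F.
  rewrite /index_const; have : 0 <= ln (block_const L Delta F + 1) by apply: ln_ge0; lra.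
  lra.
have M0 : 0 <= M by rewrite /M le_max mulr_ge0 ?invr_ge0 ?exprn_ge0 ?(ltW thr0).
by apply: mulr_ge0; [apply: mulr_ge0 => //; apply: mulr_ge0; lra|lra].
Qed.

(** A bootstrap: [block_length_le] bounds [2 ^ k] through [ell_k], which itself grows with [k].
    Taking logarithms first gives [k] of order [Lam], hence [ell_k] of order [Lam], and the bound is
    then read again. *)
Lemma block_length_rate k :
  (blockS k)%:R * (alpha_sc n L F thr delta k * n%:R * (thr ^+ 2 / 5)) <= Delta ->
  4 * (n%:R * 2 ^+ k) <=
    4 * block_const L Delta F * (2 + c_ell + 3 * index_const L Delta F) * M * Lam.
Proof.
move=> hk; have n0' : 0 < n%:R :> R by rewrite ltr0n.
have [L1 [ln1 [ld1 lt1]]] := (Lam1, (ln_n, (ln_d, ln_t))).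
have c0 := c_ell_ge0; have b0 := block_const_ge0.
have l0 := ell_sc_gt0 n0 delta0 delta1 k.
set l := ell_sc n delta k in l0; set b := block_const L Delta F in b0 *.
have lle : l <= c_ell + Lam + 3 * k%:R.
  by have := ell_sc_le n0 delta0 k; rewrite -/l -/c_ell /Lam; lra.
have i0 j : 0 <= thr ^- j by rewrite invr_ge0 exprn_ge0// ltW.
have M0 : 0 <= M.
  by rewrite /M le_max mulr_ge0.
have h1 : n%:R * 2 ^+ k <= b * (1 + l) * M.
  have := block_length_le n0 delta0 delta1 L0 F0 thr0 D0 hk; rewrite -/l => h.
  apply: le_trans h _.
  have m1 : n%:R * thr ^- 2 <= M by rewrite /M le_max lexx.
  have m2 : Num.sqrt n%:R * thr ^- 3 <= M by rewrite /M le_max lexx orbT.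
  have a0 : 0 <= 20 * L * Delta by rewrite !mulr_ge0 ?(ltW L0).
  have a1 : 0 <= 40 * L * Delta * Num.sqrt (constA L * F) by rewrite !mulr_ge0 ?sqrtr_ge0 ?(ltW L0).
  have g1 := ler_wpM2l a0 m1.
  have g2 := ler_wpM2l (mulr_ge0 a1 (ltW l0)) m2.
  have g3 := mulr_ge0 (mulr_ge0 a0 (ltW l0)) M0.
  have g4 := mulr_ge0 a1 M0.
  by rewrite /b /block_const; lra.
(* Crude, but dividing by [n] then leaves a bound on [2 ^ k] whose logarithm is controlled by
   [Lam]. *)
have Mle : M <= n%:R * thr ^- 3.
  rewrite /M ge_max; apply/andP; split.
    apply: ler_wpM2l; first exact: ler0n.
    by rewrite lef_pV2 ?posrE ?exprn_gt0// exprSr ler_piMr ?exprn_ge0// ltW.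
  apply: ler_wpM2r; first exact: i0.
  rewrite -(@ler_pXn2r _ 2)// ?nnegrE ?sqrtr_ge0// sqr_sqrtr ?ler0n//.
  by rewrite expr2 ler_peMl.
pose y := 1 + c_ell + Lam + 3 * k%:R.
have k0 : 0 <= k%:R :> R by [].
have y0 : 0 < y by rewrite /y; lra.
have h2 : 2 ^+ k <= (b + 1) * (1 / thr) ^+ 3 * y.
  rewrite -(@ler_pM2l _ n%:R)//; apply: le_trans h1 _.
  apply: (@le_trans _ _ ((b + 1) * y * (n%:R * thr ^- 3))).
    apply: ler_pM => //; first by rewrite mulr_ge0//; lra.
    by apply: ler_pM => //; rewrite ?/y; lra.
  by rewrite div1r exprVn; lra.
have h3 : ln 2 *+ k <= ln (b + 1) + ln (1 / thr) *+ 3 + ln y.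
  have t0 : 0 < 1 / thr by rewrite divr_gt0.
  have bp : 0 < b + 1 by lra.
  rewrite -!lnXn// -!lnM ?posrE ?mulr_gt0 ?invr_gt0 ?exprn_gt0//.
  by rewrite ler_ln ?posrE ?mulr_gt0 ?invr_gt0 ?exprn_gt0.
(* The weight [1/12] turns the [3 k] inside [y] into [k / 4], which [k / 2 <= k ln 2] absorbs. *)
have h4 : ln y <= y / 12 + 12.
  have -> : y = (y / 12) * 12 by field.
  rewrite lnM ?posrE ?divr_gt0//.
  have := ln_le_id (divr_gt0 y0 (ltr0Sn R 11)); have := @ln_le_id 12 (ltr0Sn R 11).
  rewrite mulfK//; lra.
have h5 : k%:R * (1 / 2) <= ln 2 *+ k :> R.
  by rewrite -[leRHS]mulr_natl ler_wpM2l// ln2_ge.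
have lb : 0 <= ln (b + 1) by apply: ln_ge0; lra.
have h6 : k%:R <= index_const L Delta F * Lam.
  rewrite /index_const -/b.
  have g1 : ln (b + 1) * 1 <= ln (b + 1) * Lam by exact: ler_wpM2l.
  have g2 : c_ell * 1 <= c_ell * Lam by exact: ler_wpM2l.
  move: h3 h4; rewrite /y -(mulr_natl (ln (1 / thr))) => h3 h4.
  have g3 : ln (1 / thr) <= Lam by rewrite /Lam; lra.
  lra.
have h7 : 1 + l <= (2 + c_ell + 3 * index_const L Delta F) * Lam.
  have g2 : c_ell * 1 <= c_ell * Lam by exact: ler_wpM2l.
  lra.
have := ler_wpM2l (mulr_ge0 b0 M0) h7.
lra.
Qed.

End Rate.

End StepSizes.

(** * A run without bad permutations *)

Section Locality.
Context {R : realType} {n d : nat}.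
Variables (f : 'I_n -> 'rV[R]_d -> R) (alpha : nat -> R) (x0 : 'rV[R]_d).

Lemma eq_rr_iter s s' t : (forall u, (u < t)%N -> s u = s' u) ->
  rr_iter f alpha s x0 t = rr_iter f alpha s' x0 t.
Proof.
elim: t => [//|t IH] h /=; rewrite IH => [|u ut]; first by rewrite h.
by apply: h; rewrite ltnS ltnW.
Qed.

Lemma eq_rr_g s s' t : (forall u, (u <= t)%N -> s u = s' u) ->
  rr_g f alpha s x0 t = rr_g f alpha s' x0 t.
Proof.
move=> h; rewrite /rr_g (@eq_rr_iter s s') => [|u ut]; last by rewrite h// ltnW.
by rewrite h.
Qed.

Lemma eq_rr_stops_at s s' thr t : (forall u, (u <= t)%N -> s u = s' u) ->
  rr_stops_at f alpha s x0 thr t -> rr_stops_at f alpha s' x0 thr t.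
Proof.
move=> h [h1 h2]; split; first by rewrite -(eq_rr_g h).
by move=> u ut; rewrite -(@eq_rr_g s)//; [exact: h2|move=> v vu; rewrite h// (leq_trans vu)// ltnW].
Qed.

(** Pads a finite history with the identity so that [rr_iter] can run on it; by [eq_rr_iter] the
    padding does not affect iterates up to [t]. *)
Definition extend t (h : 'I_t -> 'S_n) (u : nat) : 'S_n := oapp h 1%g (insub u).

Lemma extendE t (s : nat -> 'S_n) u : (u < t)%N -> extend (fun v : 'I_t => s v) u = s u.
Proof. by move=> ut; rewrite /extend insubT. Qed.

End Locality.

Section Run.
Context {R : realType} {n d : nat}.
Variables (f : 'I_n -> 'rV[R]_d -> R) (L fbar : R) (fbar_ : 'I_n -> R) (x0 : 'rV[R]_d).
Variables (thr delta : R) (alpha : nat -> R).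
Hypotheses (n0 : (0 < n)%N) (L0 : 0 < L).
Hypothesis df : forall i x, differentiable (f i : 'rV[R]_d -> R^o) x.
Hypothesis lf : forall i, lipschitz_grad L (f i).
Hypothesis hf : forall i x, fbar_ i <= f i x.
Hypothesis hfbar : forall x, fbar <= favg f x.
Hypothesis B0 : 0 <= constB L fbar fbar_.
Hypotheses (thr0 : 0 < thr) (delta0 : 0 < delta) (delta1 : delta < 1).

Let F := constF f L fbar fbar_ x0.
Let W := n%:R * constA L * F / 3.
Let Delta := favg f x0 - fbar.

Hypothesis halpha : forall k t : nat, (blockT k <= t < blockT k + blockS k)%N ->
  alpha t = alpha_sc n L F thr delta k.

Lemma Delta_ge0 : 0 <= Delta. Proof. by rewrite subr_ge0. Qed.

Lemma constF_ge0 : 0 <= F.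
Proof.
have D0 := Delta_ge0; rewrite /F /constF -/Delta.
apply: addr_ge0; first exact: mulr_ge0.
by apply: divr_ge0; apply: mulr_ge0 => //; exact: ltW.
Qed.

(** The variance is at most the second moment, which [sqr_grad_le] bounds termwise. In [W] the value
    [fbar] cancels: [W = 2 L (n f(x0) - \sum_i fbar_ i)]. *)
Lemma grad_energy_le x : favg f x <= favg f x0 ->
  \sum_i enorm (grad (f i) x - grad (favg f) x) ^+ 2 <= W.
Proof.
move=> hx; have nR : 0 < n%:R :> R by rewrite ltr0n.
set gx := grad (favg f) x.
have sgx : \sum_i grad (f i) x = n%:R *: gx.
  by rewrite /gx grad_favg// scalerA divff ?gt_eqF// scale1r.
apply: (@le_trans _ _ (\sum_i enorm (grad (f i) x) ^+ 2)).
  rewrite (eq_bigr (fun i => enorm (grad (f i) x) ^+ 2 +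
      (- 2 * dotv gx (grad (f i) x) + enorm gx ^+ 2))); last first.
    by move=> i _; rewrite enormBsqr (dotvC _ gx); ring.
  rewrite !big_split/= -[X in _ + (X + _)]mulr_sumr -dotv_sumr sgx dotvZr -enorm_sqr.
  rewrite sumr_const card_ord -[X in _ + (_ + X)]mulr_natl gerDl.
  by have := mulr_ge0 (ltW nR) (sqr_ge0 (enorm gx)); lra.
apply: (@le_trans _ _ (\sum_i 2 * L * (f i x - fbar_ i))).
  apply: ler_sum => i _; apply: sqr_grad_le => //.
rewrite -mulr_sumr sumrB.
have -> : \sum_i f i x = n%:R * favg f x by rewrite /favg mulVKf// gt_eqF.
have -> : W = 2 * L * (n%:R * favg f x0 - \sum_i fbar_ i).
  rewrite /W /F /constF /constB /constA sumrB sumr_const card_ord -mulr_natl.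
  by field; rewrite !gt_eqF.
apply: ler_wpM2l; first by rewrite mulr_ge0 ?(ltW L0).
by rewrite lerD2r ler_pM2l.
Qed.

(* Emptied when the objective exceeds its initial value, so that the size bound
   below holds for every [x]. *)
Definition bad_perms (k : nat) (x : 'rV[R]_d) : {set 'S_n} :=
  [set s : 'S_n | (favg f x <= favg f x0) && [exists m : 'I_n,
    4 * Num.sqrt W * ell_sc n delta k <
      enorm (\sum_(j < n | (j < m)%N) (grad (f (s j)) x - grad (favg f) x))]]%SET.

Lemma card_bad_perms k x :
  #|bad_perms k x|%:R <= 5 / 2 * n%:R * expR (- ell_sc n delta k) * n`!%:R.
Proof.
have l0 := ell_sc_gt0 n0 delta0 delta1 k.
rewrite /bad_perms; case: (boolP (favg f x <= favg f x0)) => hx /=.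
  pose v i := grad (f i) x - grad (favg f) x.
  apply: (@card_reshuffle_max_tail _ _ _ v) => //; last exact: ltW.
    rewrite sumrB sumr_const card_ord grad_favg// -scaler_nat scalerA.
    by rewrite divff ?pnatr_eq0 -?lt0n// scale1r subrr.
  exact: grad_energy_le.
rewrite (_ : finset _ = finset.set0) ?cards0 ?mulr_ge0 ?expR_ge0//.
Qed.

Section GoodRun.
Variables (s : nat -> 'S_n) (K : nat).
Let x := rr_iter f alpha s x0.
Let phi t := favg f (x t).
Let g := rr_g f alpha s x0.
Let N := blockT K.+1.
Let dec k := alpha_sc n L F thr delta k * n%:R * (thr ^+ 2 / 5).
Hypothesis long : Delta < (blockS K)%:R * dec K.
Hypothesis good : forall t, (t < N)%N -> s t \notin bad_perms (block_index t) (x t).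

Let dec_ge0 k : 0 <= dec k.
Proof.
have a0 := alpha_sc_gt0 n0 delta0 delta1 L0 constF_ge0 thr0 k.
apply: mulr_ge0; last by rewrite divr_ge0 ?sqr_ge0.
by apply: mulr_ge0 (ltW a0) _.
Qed.

Lemma good_epoch t : (t < N)%N -> phi t <= phi 0 ->
  (enorm (g t) <= thr -> enorm (grad (favg f) (x t)) <= Num.sqrt (28%:R / 9%:R) * thr) /\
  (thr < enorm (g t) -> phi t.+1 <= phi t - dec (block_index t)).
Proof.
move=> tN hphi; have tb := block_indexP t; set k := block_index t in tb *.
have aE := halpha tb.
have := good tN; rewrite -/k /bad_perms inE hphi /= negb_exists => /forallP hm.
have a0 := alpha_sc_gt0 n0 delta0 delta1 L0 constF_ge0 thr0 k.
have anL : alpha_sc n L F thr delta k * n%:R * L <= 1 / 4 by exact: alpha_sc_le.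
have aLD := alpha_sc_deviation_le n0 delta0 delta1 L0 constF_ge0 thr0 k.
rewrite /dec -aE.
rewrite -aE in a0 anL aLD.
have hD2 (m : 'I_n) : enorm (\sum_(j < n | (j < m)%N)
    (grad (f (s t j)) (x t) - grad (favg f) (x t))) <=
    4 * Num.sqrt W * ell_sc n delta k by have := hm m; rewrite -leNgt.
exact: (epoch_dichotomy n0 L0 (ltW a0) anL df lf thr0 hD2 aLD).
Qed.

(** [good_epoch] needs [phi t <= phi 0], and its conclusion restores this for the next epoch; the
    invariant [le0] is therefore proved first. *)
Lemma running_decrease T : (T <= N)%N -> (forall t, (t < T)%N -> thr < enorm (g t)) ->
  forall u t, (u <= t <= T)%N -> phi t <= phi u.
Proof.
move=> TN run u t /andP[ut tT].
have dec0 v : (v < T)%N -> phi v <= phi 0 -> phi v.+1 <= phi v.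
  move=> vT hv; have [_ /(_ (run v vT))] := good_epoch (leq_trans vT TN) hv.
  by have := dec_ge0 (block_index v); lra.
have le0 v : (v <= T)%N -> phi v <= phi 0.
  elim: v => [//|v IH vT]; have hv := IH (ltnW vT).
  exact: le_trans (dec0 v vT hv) hv.
elim: t ut tT => [|t IH]; first by rewrite leqn0 => /eqP ->.
rewrite leq_eqVlt => /predU1P[->//|]; rewrite ltnS => ut tT.
by apply: le_trans (dec0 t tT (le0 t (ltnW tT))) (IH ut (ltnW tT)).
Qed.

(** Each epoch of the block lowers [phi] by [dec k], while the total decrease cannot exceed
    [Delta]. *)
Lemma running_block k : (blockT k.+1 <= N)%N ->
  (forall t, (t < blockT k.+1)%N -> thr < enorm (g t)) -> (blockS k)%:R * dec k <= Delta.
Proof.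
move=> kN run; have mono := running_decrease kN run.
have kS := blockTS k.
have h m : (m <= blockS k)%N -> phi (blockT k + m) <= phi (blockT k) - m%:R * dec k.
  elim: m => [|m IH] hm; first by rewrite addn0 mul0r subr0.
  have vk : (blockT k + m < blockT k.+1)%N by rewrite kS ltn_add2l.
  have bi : block_index (blockT k + m) = k.
    by apply: block_index_eq; rewrite leq_addr ltn_add2l.
  have [|_ /(_ (run _ vk))] := good_epoch (leq_trans vk kN).
    by apply: mono; rewrite leq0n ltnW.
  rewrite bi addnS -natr1 => h; have := IH (ltnW hm); lra.
have h1 := h _ (leqnn _).
have h2 : phi (blockT k) <= phi 0 by apply: mono; rewrite leq0n kS leq_addr.
have h3 := hfbar (x (blockT k + blockS k)).
have : phi 0 = favg f x0 by [].
rewrite /Delta; rewrite -/(phi _) in h3; lra.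
Qed.

(** Running through block [K] without stopping would contradict [long] by [running_block], so the
    first stopping time lies before [N]. *)
Lemma good_run_stops : exists tau : nat,
  [/\ rr_stops_at f alpha s x0 thr tau,
      thr <= 1 ->
        n%:R * tau%:R <= rate_const L Delta (constB L fbar fbar_) *
          Num.max (n%:R * thr ^- 2) (Num.sqrt n%:R * thr ^- 3) *
          (1 + ln n%:R + ln (1 / delta) + ln (1 / thr)) ^+ 1 &
      enorm (grad (favg f) (x tau)) <= Num.sqrt (28%:R / 9%:R) * thr].
Proof.
have ex : exists t, enorm (g t) <= thr.
  apply: contrapT => hno.
  have run t : thr < enorm (g t) by rewrite ltNge; apply/negP => h; apply: hno; exists t.
  have := running_block (leqnn _) (fun t _ => run t).
  by rewrite leNgt long.
have tauN : (ex_minn ex < N)%N.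
  rewrite ltnNge; apply/negP => hN.
  have run t : (t < N)%N -> thr < enorm (g t).
    move=> tN; rewrite ltNge; apply/negP; case: ex_minnP hN => m _ hmin hN ht.
    by have := hmin _ ht; rewrite leqNgt (leq_trans tN).
  have := running_block (leqnn _) run.
  by rewrite leNgt long.
case: ex_minnP tauN => tau htau hmin tauN; exists tau.
have run t : (t < tau)%N -> thr < enorm (g t).
  by move=> tt; rewrite ltNge; apply/negP => /hmin; rewrite leqNgt tt.
split.
- by split=> // t tt; apply/negP; rewrite -ltNge run.
- move=> thr1; have D0 := Delta_ge0; rewrite expr1.
  (* Block [0] is the single epoch [0]. If [tau] lies in block [k + 1], then block [k] was passed in
     full and [tau < 4 * 2 ^ k]. *)
  have := block_indexP tau; case: (block_index tau) => [|k] /andP[k1 k2].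
    have -> : tau = 0%N by move: k2; rewrite -blockTS /blockT big_nat1 ltnS leqn0 => /eqP.
    rewrite mulr0; apply: (rate_ge0 F n0 delta0 delta1 L0 thr0 thr1 D0).
  have runk : forall t, (t < blockT k.+1)%N -> thr < enorm (g t).
    by move=> t tk; apply: run; exact: leq_trans k1.
  have := running_block (leq_trans k1 (ltnW tauN)) runk.
  move=> /(block_length_rate n0 delta0 delta1 L0 constF_ge0 thr0 thr1 D0) h.
  apply: le_trans h.
  rewrite mulrCA ler_wpM2l//.
  rewrite -natrX -natrM ler_nat -(expnD 2 2) -blockT_expn.
  by move: k2; rewrite -blockTS add2n; lia.
- have h0 : phi tau <= phi 0 by apply: (running_decrease (ltnW tauN) run); rewrite leq0n leqnn.
  by have [/(_ htau)] := good_epoch tauN h0.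
Qed.

End GoodRun.
End Run.

(** * Measurability and probability of the success event *)

Theorem theorem4p5 (R : realType) :
  exists (p : nat) (C : R -> R -> R -> R),
  forall (n d : nat) (f : 'I_n -> 'rV[R]_d -> R) (L fbar : R)
    (fbar_ : 'I_n -> R) (x0 : 'rV[R]_d) (eta eps delta : R) (alpha : nat -> R)
    (dT : measure_display) (T : measurableType dT) (P : probability T R)
    (perms : nat -> T -> 'S_n),
  (0 < n)%N ->
  0 < L ->
  (forall i, continuously_differentiable (f i)) ->
  (forall i, lipschitz_grad L (f i)) ->
  (forall i x, fbar_ i <= f i x) ->
  (forall x, fbar <= favg f x) ->
  0 <= constB L fbar fbar_ ->
  0 < eta -> 0 < eps -> 0 < delta -> delta < 1 ->
  (forall k t : nat, (blockT k <= t < blockT k + blockS k)%N ->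
     alpha t =
       alpha_sc n L (constF f L fbar fbar_ x0) (eta * eps) delta k) ->
  rr_sampling P perms ->
  let E : set T := [set w | exists tau : nat,
    let s : nat -> 'S_n := fun t => perms t w in
    [/\ rr_stops_at f alpha s x0 (eta * eps) tau,
        eta * eps <= 1 ->
          n%:R * tau%:R <=
            C L (favg f x0 - fbar) (constB L fbar fbar_) *
            Num.max (n%:R * (eta * eps) ^- 2)
                    (Num.sqrt n%:R * (eta * eps) ^- 3) *
            (1 + ln n%:R + ln (1 / delta) + ln (1 / (eta * eps))) ^+ p &
        enorm (grad (favg f) (rr_iter f alpha s x0 tau)) <=
          Num.sqrt (28%:R / 9%:R) * (eta * eps)]] in
  measurable E /\ ((1 - delta)%:E <= P E)%E.
Proof.
exists 1%N, (@rate_const R).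
move=> n d f L fbar fbar_ x0 eta eps delta alpha dT T P perms.
move=> n0 L0 cdf lf hf hfbar B0 eta0 eps0 delta0 delta1 halpha hs E.
have thr0 : 0 < eta * eps by exact: mulr_gt0.
have df i x : differentiable (f i : 'rV[R]_d -> R^o) x by case: (cdf i).
have mE : measurable E.
  (* For fixed [tau] the conditions depend on the first [tau + 1] permutations only, so [E] is a
     countable union of cylinders. *)
  pose Q tau (s : nat -> 'S_n) := [/\ rr_stops_at f alpha s x0 (eta * eps) tau,
        eta * eps <= 1 ->
          n%:R * tau%:R <=
            rate_const L (favg f x0 - fbar) (constB L fbar fbar_) *
            Num.max (n%:R * (eta * eps) ^- 2)
                    (Num.sqrt n%:R * (eta * eps) ^- 3) *
            (1 + ln n%:R + ln (1 / delta) + ln (1 / (eta * eps))) ^+ 1 &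
        enorm (grad (favg f) (rr_iter f alpha s x0 tau)) <=
          Num.sqrt (28%:R / 9%:R) * (eta * eps)].
  have Qloc tau s s' : (forall u, (u <= tau)%N -> s u = s' u) -> Q tau s -> Q tau s'.
    move=> h [h1 h2 h3]; split; [exact: eq_rr_stops_at h1|exact: h2|].
    by rewrite -(@eq_rr_iter _ _ _ _ _ _ s) => [|u ut]; [exact: h3|rewrite h ?(ltnW ut)].
  rewrite (_ : E = \bigcup_tau [set w |
      (fun h : 'I_tau.+1 -> 'S_n => Q tau (extend h)) (fun u : 'I_tau.+1 => perms u w)]).
    by apply: bigcup_measurable => tau _;
      exact: (measurable_cylinder hs (fun h : 'I_tau.+1 -> 'S_n => Q tau (extend h))).
  apply/seteqP; split=> w.
    move=> [tau hQ]; exists tau; first exact: I.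
    by apply: Qloc hQ => u ut; rewrite (extendE (fun t => perms t w)).
  move=> [tau _ /= hQ]; exists tau.
  by apply: Qloc hQ => u ut; rewrite (extendE (fun t => perms t w)).
split=> //.
pose F := constF f L fbar fbar_ x0; pose thr := eta * eps.
have F0 : 0 <= F by exact: constF_ge0.
have D0 : 0 <= favg f x0 - fbar by rewrite subr_ge0.
have [K long] := exists_long_block (F := F) n0 delta0 delta1 L0 F0 thr0 D0.
pose N := blockT K.+1.
(* Written through [extend], so that the bad set is a function of the history before [t], as
   [prob_bad_le] requires. *)
pose Bad t := [set w | perms t w \in
  bad_perms f L fbar fbar_ x0 delta (block_index t)
    (rr_iter f alpha (extend (fun u : 'I_t => perms u w)) x0 t)].
pose q k := 5 / 2 * n%:R * expR (- ell_sc n delta k) : R.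
have mBad t : measurable (Bad t).
  exact: (measurable_cylinder hs (fun h : 'I_t.+1 -> 'S_n => h ord_max \in
    bad_perms f L fbar fbar_ x0 delta (block_index t)
      (rr_iter f alpha (extend (fun u : 'I_t => h (widen_ord (leqnSn t) u))) x0 t))).
have PBad t : (P (Bad t) <= (q (block_index t))%:E)%E.
  apply: (prob_bad_le hs (Bad := fun h => bad_perms f L fbar fbar_ x0 delta (block_index t)
    (rr_iter f alpha (extend h) x0 t))) => h.
  exact: card_bad_perms.
pose U := \big[setU/set0]_(t < N) Bad t.
have mU : measurable U by apply: bigsetU_measurable.
have PU : (P U <= delta%:E)%E.
  apply: (le_trans (Boole_inequality _ (fun t _ => mBad t))).
  apply: (le_trans (lee_sum _ (fun (t : 'I_N) _ => PBad t))).
  rewrite sumEFin lee_fin -(big_mkord xpredT (fun t => q (block_index t))) big_blocks.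
  rewrite (eq_bigr (fun k => 5 / 16 * delta_sc delta k)) => [|k _]; last first.
    by rewrite -[LHS]mulr_natl /q tail_budget.
  (* The total is at most [5/16 * 3 delta = 15/16 delta]. *)
  by rewrite -mulr_sumr; have := sum_delta_sc delta0 K.+1; lra.
apply: (@le_trans _ _ (P (~` U))).
  by rewrite probability_setC// EFinB leeB.
apply: le_measure; rewrite ?inE//; first exact: measurableC.
move=> w nUw.
have good t : (t < N)%N -> perms t w \notin bad_perms f L fbar fbar_ x0 delta
    (block_index t) (rr_iter f alpha (fun u => perms u w) x0 t).
  move=> tN; apply/negP => hb; apply: nUw.
  rewrite /U -bigcup_mkord; exists t; first exact: tN.
  rewrite /Bad /mkset (@eq_rr_iter _ _ _ _ _ _ _ (fun u => perms u w))// => u ut.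
  exact: (extendE (fun t => perms t w)).
have H := good_run_stops n0 L0 df lf hfbar B0 thr0 delta0 delta1 halpha long good.
exact: H.
Qed.
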